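(* In the setting described in the context: if the model is robust in data (RID), then $\mathcal P_0=(X,\Theta)$ is not geometrically ergodic; and if the model is robust in parameter (RIP), then $\mathcal P_1=(\tilde X,\Theta)$ is not geometrically ergodic.
   Context: Fix an observed value $y\in\mathbb R$. Consider the model $Y=X+Z_1$, $X=\Theta+Z_2$, where $Z_1,Z_2$ are independent real random variables, independent of $\Theta$, whose distributions are symmetric about $0$ and have continuous, bounded, everywhere positive Lebesgue densities $f_1,f_2$; $\Theta$ is given the improper flat (Lebesgue) prior on $\mathbb R$, and the posterior $\mathcal L(X,\Theta\mid Y=y)$ is proper. Write $\tilde X=X-\Theta$. For a parametrisation $\mathcal P=(U,\Theta)$ with $U\in\{X,\tilde X\}$, the Gibbs sampler started at $\Theta_0$ iterates, for $n\ge1$: draw $U_n\sim\mathcal L(U\mid Y=y,\Theta=\Theta_{n-1})$, then $\Theta_n\sim\mathcal L(\Theta\mid Y=y,U=U_n)$. The centred parametrisation is $\mathcal P_0=(X,\Theta)$ and the non-centred one is $\mathcal P_1=(\tilde X,\Theta)$. A parametrisation is called geometrically ergodic if its marginal chain $\{\Theta_n\}$ satisfies $\|\mathcal L(\Theta_n\mid Y=y,\Theta_0)-\mathcal L(\Theta\mid Y=y)\|_{TV}\le M(\Theta_0)r^n$ for all $n$, for some $r<1$ and some function $M$. The model is RIP (robust in parameter) if $\mathcal L(X\mid Y=y,\Theta=\theta)\to\mathcal L(Z_1+y)$ weakly as $|\theta|\to\infty$, and RID (robust in data) if $\mathcal L(\tilde X\mid Y=y,\Theta=\theta)\to\mathcal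 L(\tilde X)=\mathcal L(Z_2)$ weakly as $|\theta|\to\infty$. *)

(* Defs.v *)
(* classical reals. All laws in this model have Lebesgue densities,
   so everything is expressed through densities and (improper) Riemann integrals. *)
From Stdlib Require Import Reals ClassicalEpsilon.
Open Scope R_scope.

Definition is_RInt_R (f : R -> R) (l : R) : Prop :=
  exists pr : (forall a b : R, Riemann_integrable f a b),
    forall eps : R, eps > 0 -> exists A : R,
      forall a b : R, a <= - A -> A <= b -> Rabs (RiemannInt (pr a b) - l) < eps.

(* The value of the integral over R (chosen; meaningful when it exists). *)
Definition RInt_R (f : R -> R) : R :=
  epsilon (inhabits 0) (fun l => is_RInt_R f l).

Definition is_bounded (f : R -> R) : Prop := exists B : R, forall x, Rabs (f x) <= B.

Definition good_density (f : R -> R) : Prop :=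
  continuity f /\ is_bounded f /\ (forall x, 0 < f x) /\ (forall x, f (- x) = f x)
  /\ is_RInt_R f 1.

(* ---------- The model  Y = X + Z1,  X = Theta + Z2,  flat prior on Theta ---------- *)
(* Unnormalised joint posterior density of (X,Theta) given Y=y: f1(y-x) f2(x-theta). *)

(* Normalising constant of L(X | Y=y, Theta=th) : int f1(y-x) f2(x-th) dx.
   (It is also the unnormalised posterior density of Theta.) *)
Definition cX (f1 f2 : R -> R) (y th : R) : R :=
  RInt_R (fun x => f1 (y - x) * f2 (x - th)).

Definition post_theta (f1 f2 : R -> R) (y : R) (th : R) : R :=
  cX f1 f2 y th / RInt_R (fun t => cX f1 f2 y t).

Definition condX (f1 f2 : R -> R) (y th x : R) : R :=
  f1 (y - x) * f2 (x - th) / cX f1 f2 y th.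
(* density of L(Theta | Y=y, X=x) at th (flat prior times f2(x-th), normalised) *)
Definition condTheta_X (f1 f2 : R -> R) (y x th : R) : R :=
  f2 (x - th) / RInt_R (fun t => f2 (x - t)).

(* Non-centred parametrisation P1 = (Xtilde, Theta), Xtilde = X - Theta. *)
Definition cXt (f1 f2 : R -> R) (y th : R) : R :=
  RInt_R (fun u => f1 (y - th - u) * f2 u).
Definition condXt (f1 f2 : R -> R) (y th u : R) : R :=
  f1 (y - th - u) * f2 u / cXt f1 f2 y th.
Definition condTheta_Xt (f1 f2 : R -> R) (y u th : R) : R :=
  f1 (y - u - th) / RInt_R (fun t => f1 (y - u - t)).

(* a th u : density of U given Theta=th ; b u th' : density of Theta given U=u.
   Transition density of the Theta-chain. *)
Definition gibbs_kernel (a b : R -> R -> R) (th th' : R) : R :=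
  RInt_R (fun u => a th u * b u th').

(* theta_dens K n th0 = density of L(Theta_{n+1} | Y=y, Theta_0 = th0). *)
Fixpoint theta_dens (K : R -> R -> R) (n : nat) (th0 : R) : R -> R :=
  match n with
  | O => K th0
  | S m => fun th' => RInt_R (fun t => theta_dens K m th0 t * K t th')
  end.

Definition tv_dist (p q : R -> R) : R := / 2 * RInt_R (fun t => Rabs (p t - q t)).

Definition geom_ergodic (a b : R -> R -> R) (pi : R -> R) : Prop :=
  exists (r : R) (M : R -> R), r < 1 /\
    forall (th0 : R) (n : nat),
      tv_dist (theta_dens (gibbs_kernel a b) n th0) pi <= M th0 * r ^ (S n).

Definition P0_geom_ergodic (f1 f2 : R -> R) (y : R) : Prop :=
  geom_ergodic (condX f1 f2 y) (condTheta_X f1 f2 y) (post_theta f1 f2 y).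

Definition P1_geom_ergodic (f1 f2 : R -> R) (y : R) : Prop :=
  geom_ergodic (condXt f1 f2 y) (condTheta_Xt f1 f2 y) (post_theta f1 f2 y).

Definition weak_conv_at_infty (p : R -> R -> R) (q : R -> R) : Prop :=
  forall h : R -> R, continuity h -> is_bounded h ->
    forall eps : R, eps > 0 -> exists T : R, forall th : R, T < Rabs th ->
      Rabs (RInt_R (fun x => h x * p th x) - RInt_R (fun x => h x * q x)) < eps.

(* RIP: L(X | Y=y, Theta=th) -> L(Z1 + y) (density x |-> f1(x - y)). *)
Definition RIP (f1 f2 : R -> R) (y : R) : Prop :=
  weak_conv_at_infty (condX f1 f2 y) (fun x => f1 (x - y)).

(* RID: L(Xtilde | Y=y, Theta=th) -> L(Z2) (density f2). *)
Definition RID (f1 f2 : R -> R) (y : R) : Prop :=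
  weak_conv_at_infty (condXt f1 f2 y) f2.

Definition posterior_proper (f1 f2 : R -> R) (y : R) : Prop :=
  exists Z : R, 0 < Z /\ is_RInt_R (fun th => cX f1 f2 y th) Z.

(* Main.v *)
(** Write phi(x) = f1(y-x), f = f2, and c(t) for the integral of phi(x) f(x-t) dx, the unnormalised
    posterior density of Theta, of total mass Z. The Theta-chain of P0 is reversible with respect
    to c. Let p_j be the density of Theta_{j+1} started at t0 and
    E_j = int p_j^2/c - 1/Z, the squared distance from equilibrium in L^2. By reversibility and
    Cauchy-Schwarz E_{j+1}^2 <= E_j E_{j+2}, so any total variation rate C(t0) r^j forces
    E_j <= E_0 r^j, with no trace of C(t0), and E_0 <= B/c(t0) where B = sup f.

    If the model is RID, the kernel far out is tight around its starting point, hence p_j keeps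
    mass at least (1-eps)^(j+1) in the window of half-length L = (j+1)A around t0 for t0 large;
    also c varies slowly, and the integral of c over that window is at most K L^2 c(t0).
    Cauchy-Schwarz gives
      (1-eps)^(2(j+1)) <= (B r^j / c(t0) + 1/Z) K L^2 c(t0),
    and letting t0 escape to infinity along c(t0) -> 0, the right side becomes a quadratic
    polynomial in j times r^j: a contradiction once (1-eps)^2 > r and j is large.

    Replacing x by y-x exchanges (f1,f2), P0 with P1, and RID with RIP. *)
Require Import Defs.
From Stdlib Require Import Reals Lra Lia Classical ClassicalEpsilon.
From Stdlib Require Import FunctionalExtensionality PropExtensionality.
From Coquelicot Require Import Coquelicot.
Open Scope R_scope.

(** * Improper integrals of nonnegative continuous functions *)

(** The obstacle is that the constant in the ergodicity bound may grow arbitrarily fast with the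
    starting point, so slow escape from far out does not by itself contradict the bound. Passing to
    L^2 removes the constant: total variation controls the energy because p_j / c stays below B /
    c(t0), and a log-convex sequence of order r^j has every successive ratio at most r. The
    remaining factor 1 / c(t0) is of a known size, and it cancels against the c(t0) in the mass of
    the window. The order of choices matters: r fixes eps, eps fixes A, then j is chosen, and t0
    comes last. Hence the window constant K must not depend on L, while the thresholds beyond which
    t0 has to lie may depend on everything chosen before. *)

Definition cont {T : UniformSpace} (f : T -> R) : Prop := forall x, continuous f x.

(** The parameter space is an arbitrary uniform space because [overlap_jcont] needs T = R * R. *)
Definition jcont {T : UniformSpace} (G : T -> R -> R) : Prop :=
  cont (fun z : T * R => G (fst z) (snd z)).

Lemma cont_add {T : UniformSpace} (f g : T -> R) (x : T) :
  continuous f x -> continuous g x -> continuous (fun t => f t + g t) x.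
Proof. exact (continuous_plus f g x). Qed.

Lemma cont_opp {T : UniformSpace} (f : T -> R) (x : T) :
  continuous f x -> continuous (fun t => - f t) x.
Proof. exact (continuous_opp f x). Qed.

Lemma cont_sub {T : UniformSpace} (f g : T -> R) (x : T) :
  continuous f x -> continuous g x -> continuous (fun t => f t - g t) x.
Proof. exact (continuous_minus f g x). Qed.

Lemma cont_mul {T : UniformSpace} (f g : T -> R) (x : T) :
  continuous f x -> continuous g x -> continuous (fun t => f t * g t) x.
Proof. exact (continuous_mult f g x). Qed.

Lemma cont_div {T : UniformSpace} (f g : T -> R) (x : T) :
  continuous f x -> continuous g x -> g x <> 0 -> continuous (fun t => f t / g t) x.
Proof.
  intros Hf Hg H. apply cont_mul; [exact Hf|].
  apply (continuous_comp g Rinv x Hg). now apply continuous_Rinv.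
Qed.

Lemma cont_comp {T U : UniformSpace} (e : T -> U) (g : U -> R) (x : T) :
  continuous e x -> cont g -> continuous (fun t => g (e t)) x.
Proof. intros He Hg. apply (continuous_comp e g x He). apply Hg. Qed.

Lemma cont_comp2 {T U : UniformSpace} (G : U -> R -> R) (d : T -> U) (e : T -> R) (x : T) :
  jcont G -> continuous d x -> continuous e x -> continuous (fun t => G (d t) (e t)) x.
Proof. intros HG Hd He. apply (continuous_comp_2 d e G x Hd He), (HG (d x, e x)). Qed.

Lemma cont_pair {T U V : UniformSpace} (d : T -> U) (e : T -> V) (x : T) :
  continuous d x -> continuous e x -> continuous (fun t => (d t, e t)) x.
Proof.
  intros Hd He. apply (continuous_comp_2 d e (fun a b => (a, b)) x Hd He).
  eapply continuous_ext; [|apply continuous_id]. now intros [a b].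
Qed.

Lemma cont_pow {T : UniformSpace} (f : T -> R) (n : nat) (x : T) :
  continuous f x -> continuous (fun t => f t ^ n) x.
Proof.
  intros H. induction n as [|n IH]; [apply continuous_const|].
  exact (cont_mul f (fun t => f t ^ n) x H IH).
Qed.

(** Descends along the syntax of the function and uses continuity hypotheses at the leaves. What it
    may leave open are mostly nonvanishing denominators, which the callers discharge. *)
Ltac ctn := lazymatch goal with
  | |- cont _ => intro; cbv beta; ctn
  | |- jcont _ => intro; cbv beta; ctn
  | |- continuous _ _ => first [apply continuous_id | apply continuous_const | ctn_step]
  | |- _ => idtac
  end
with ctn_step := lazymatch goal with
  | |- continuous (fun x => Rabs (@?a x)) _ => apply (cont_comp a Rabs); [ctn | exact continuous_Rabs]
  | |- continuous (fun x => (@?a x) + (@?b x)) _ => apply (cont_add a b); ctn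
  | |- continuous (fun x => - (@?a x)) _ => apply (cont_opp a); ctn
  | |- continuous (fun x => (@?a x) - (@?b x)) _ => apply (cont_sub a b); ctn
  | |- continuous (fun x => (@?a x) * (@?b x)) _ => apply (cont_mul a b); ctn
  | |- continuous (fun x => (@?a x) ^ ?n) _ => apply (cont_pow a n); ctn
  | |- continuous (fun x => (@?a x) / (@?b x)) _ => apply (cont_div a b); [ctn | ctn | try assumption]
  | |- continuous (fun x => fst x) _ => apply continuous_fst
  | |- continuous (fun x => snd x) _ => apply continuous_snd
  | |- continuous (fun x => fst (@?a x)) _ =>
      apply (continuous_comp a fst); [ctn | apply continuous_fst]
  | |- continuous (fun x => snd (@?a x)) _ =>
      apply (continuous_comp a snd); [ctn | apply continuous_snd]
  | |- continuous (fun x => (@?a x, @?b x)) _ => apply (cont_pair a b); ctn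
  | |- continuous ?f ?x => try first
      [ match goal with
        | |- continuous (fun x => ?g (@?a x) (@?b x)) _ =>
            apply (cont_comp2 g a b); [assumption | ctn | ctn]
        end
      | match goal with
        | |- continuous (fun x => ?g (@?a x)) _ => apply (cont_comp a g); [ctn | assumption]
        end
      | match goal with H : cont f |- _ => exact (H x) end ]
  end.

Lemma cont_ex_RInt (f : R -> R) (a b : R) : cont f -> ex_RInt f a b.
Proof. intros H. apply (ex_RInt_continuous (V := R_CompleteNormedModule)). auto. Qed.

Lemma RInt_split (f : R -> R) (a b c : R) :
  cont f -> RInt f a c = RInt f a b + RInt f b c.
Proof.
  intros H. symmetry.
  apply (RInt_Chasles (V := R_CompleteNormedModule) f a b c); now apply cont_ex_RInt.
Qed.

Lemma RInt_nonneg (f : R -> R) (a b : R) :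
  cont f -> (forall x, 0 <= f x) -> a <= b -> 0 <= RInt f a b.
Proof. intros Hc H Hab. apply RInt_ge_0; auto. now apply cont_ex_RInt. Qed.

Lemma RInt_mono (f g : R -> R) (a b : R) :
  cont f -> cont g -> (forall x, a <= x <= b -> f x <= g x) -> a <= b -> RInt f a b <= RInt g a b.
Proof.
  intros Hf Hg H Hab. apply RInt_le; try apply cont_ex_RInt; auto.
  intros x Hx. apply H. lra.
Qed.

Lemma RInt_incl (f : R -> R) (a b c d : R) :
  cont f -> (forall x, 0 <= f x) -> c <= a -> a <= b -> b <= d -> RInt f a b <= RInt f c d.
Proof.
  intros Hc H H1 H2 H3.
  rewrite (RInt_split f c a d Hc), (RInt_split f a b d Hc).
  assert (A := RInt_nonneg f c a Hc H H1). assert (B := RInt_nonneg f b d Hc H H3). lra.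
Qed.

Lemma RInt_add (f g : R -> R) (a b : R) :
  cont f -> cont g -> RInt (fun x => f x + g x) a b = RInt f a b + RInt g a b.
Proof.
  intros Hf Hg. apply (RInt_plus (V := R_CompleteNormedModule) f g); now apply cont_ex_RInt.
Qed.

Lemma RInt_mul (k : R) (f : R -> R) (a b : R) :
  cont f -> RInt (fun x => k * f x) a b = k * RInt f a b.
Proof. intros Hf. apply (RInt_scal (V := R_CompleteNormedModule) f). now apply cont_ex_RInt. Qed.

Lemma RInt_constant (k a b : R) : RInt (fun _ => k) a b = (b - a) * k.
Proof. exact (RInt_const (V := R_CompleteNormedModule) a b k). Qed.

Lemma RInt_reflect_shift (f : R -> R) (s a b : R) :
  cont f -> RInt (fun x => f (s - x)) a b = RInt f (s - b) (s - a).
Proof.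
  intros Hf.
  assert (E := RInt_comp_lin f (-1) s a b (cont_ex_RInt _ _ _ Hf)).
  rewrite <- (opp_RInt_swap (V := R_CompleteNormedModule) f (s - a) (s - b)) by now apply cont_ex_RInt.
  replace (-1 * a + s) with (s - a) in E by ring.
  replace (-1 * b + s) with (s - b) in E by ring.
  rewrite <- E.
  rewrite <- RInt_opp.
  - apply RInt_ext. intros x _. unfold opp, scal; simpl. unfold mult; simpl.
    replace (-1 * x + s) with (s - x) by ring. ring.
  - eapply ex_RInt_ext with (f := fun x => -1 * f (-1 * x + s)).
    + reflexivity.
    + apply cont_ex_RInt. ctn.
Qed.

Lemma RInt_shift (f : R -> R) (s a b : R) :
  cont f -> RInt (fun x => f (x + s)) a b = RInt f (a + s) (b + s).
Proof.
  intros Hf.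
  assert (E := RInt_comp_lin f 1 s a b (cont_ex_RInt _ _ _ Hf)).
  rewrite !Rmult_1_l in E. rewrite <- E. apply RInt_ext. intros x _.
  unfold scal; simpl. unfold mult; simpl. now rewrite !Rmult_1_l.
Qed.

(* [intg f l]: [l] is the supremum of the integrals of [f] over bounded intervals. For
   continuous [f >= 0] this is [is_RInt_R f l], and limits are replaced by suprema. *)
Definition intg (f : R -> R) (l : R) : Prop :=
  (forall a b, a <= b -> RInt f a b <= l) /\
  (forall eps, 0 < eps -> exists A, 0 < A /\ l - eps < RInt f (- A) A).

Lemma intg_intro (f : R -> R) (l : R) :
  cont f -> (forall x, 0 <= f x) ->
  (forall a b, a <= b -> RInt f a b <= l) ->
  (forall eps, 0 < eps -> exists a b, a <= b /\ l - eps < RInt f a b) ->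
  intg f l.
Proof.
  intros Hc Hp H1 H2. split; [exact H1|].
  intros eps He. destruct (H2 eps He) as (a & b & Hab & H).
  exists (Rabs a + Rabs b + 1).
  assert (A1 := Rabs_pos a). assert (A2 := Rabs_pos b).
  assert (A3 := Rle_abs a). assert (A4 := Rle_abs b).
  assert (A5 := Rle_abs (- a)). rewrite Rabs_Ropp in A5.
  split; [lra|]. eapply Rlt_le_trans; [exact H|].
  apply RInt_incl; auto; lra.
Qed.

Lemma intg_unique (f : R -> R) (l l' : R) : intg f l -> intg f l' -> l = l'.
Proof.
  assert (W : forall l l', intg f l -> intg f l' -> l <= l').
  { intros m m' [_ H] [H' _]. apply Rnot_lt_le. intros L.
    destruct (H (m - m')) as (A & HA & B); [lra|].
    assert (C := H' (- A) A). lra. }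
  intros H H'. apply Rle_antisym; auto.
Qed.

Lemma intg_ext (f g : R -> R) (l : R) : (forall x, f x = g x) -> intg f l -> intg g l.
Proof. intros E. apply functional_extensionality in E. now subst. Qed.

Lemma intg_nonneg (f : R -> R) (l : R) : intg f l -> 0 <= l.
Proof. intros [H _]. generalize (H 0 0 (Rle_refl 0)). now rewrite RInt_point. Qed.

Lemma intg_mono (f g : R -> R) (l l' : R) :
  cont f -> cont g -> (forall x, f x <= g x) -> intg f l -> intg g l' -> l <= l'.
Proof.
  intros Hf Hg H [_ H1] [H2 _]. apply Rnot_lt_le. intros L.
  destruct (H1 (l - l')) as (A & HA & B); [lra|].
  assert (C := H2 (- A) A). assert (D := RInt_mono f g (- A) A Hf Hg (fun x _ => H x)). lra.
Qed.

(** The bound by [l'] makes the set of all interval integrals of f bounded above, and completeness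
    of R supplies the integral as its supremum. *)
Lemma intg_dominated (f g : R -> R) (l' : R) :
  cont f -> cont g -> (forall x, 0 <= f x <= g x) -> intg g l' -> exists l, intg f l.
Proof.
  intros Hf Hg H [Hu _].
  destruct (completeness (fun v => exists a b, a <= b /\ v = RInt f a b)) as [l [L1 L2]].
  - exists l'. intros v (a & b & Hab & ->).
    apply Rle_trans with (RInt g a b); auto. apply RInt_mono; auto. intros; apply H.
  - exists (RInt f 0 0), 0, 0. split; [lra|reflexivity].
  - exists l. apply intg_intro; auto; [apply H| |].
    + intros a b Hab. apply L1. eauto.
    + intros eps He. apply NNPP. intros N.
      assert (l <= l - eps); [|lra].
      apply L2. intros v (a & b & Hab & ->). apply Rnot_lt_le. intros K. apply N. eauto.
Qed.

Lemma intg_scal (k : R) (f : R -> R) (l : R) :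
  cont f -> 0 <= k -> intg f l -> intg (fun x => k * f x) (k * l).
Proof.
  intros Hf Hk [H1 H2]. split.
  - intros a b Hab. rewrite (RInt_mul k f) by auto. apply Rmult_le_compat_l; auto.
  - intros eps He. destruct (Req_dec k 0) as [->|K].
    + exists 1. split; [lra|]. rewrite RInt_mul by auto. lra.
    + destruct (H2 (eps / k)) as (A & HA & B); [apply Rdiv_lt_0_compat; lra|].
      exists A; split; auto. rewrite (RInt_mul k f) by auto.
      apply Rmult_lt_compat_l with (r := k) in B; [|lra].
      replace (k * (l - eps / k)) with (k * l - eps) in B by (field; lra). exact B.
Qed.

Lemma intg_reflect (s : R) (f : R -> R) (l : R) :
  cont f -> (forall x, 0 <= f x) -> intg f l -> intg (fun x => f (s - x)) l.
Proof.
  intros Hf Hp [H1 H2]. apply intg_intro; auto; [ctn| |].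
  - intros a b Hab. rewrite (RInt_reflect_shift f) by auto. apply H1. lra.
  - intros eps He. destruct (H2 eps He) as (A & HA & B).
    exists (s - A), (s + A). split; [lra|]. rewrite (RInt_reflect_shift f) by auto.
    replace (s - (s + A)) with (- A) by ring. now replace (s - (s - A)) with A by ring.
Qed.

Lemma intg_shift (s : R) (f : R -> R) (l : R) :
  cont f -> (forall x, 0 <= f x) -> intg f l -> intg (fun x => f (x + s)) l.
Proof.
  intros Hf Hp [H1 H2]. apply intg_intro; auto; [ctn| |].
  - intros a b Hab. rewrite (RInt_shift f) by auto. apply H1. lra.
  - intros eps He. destruct (H2 eps He) as (A & HA & B).
    exists (- A - s), (A - s). split; [lra|]. rewrite (RInt_shift f) by auto.
    replace (- A - s + s) with (- A) by ring. now replace (A - s + s) with A by ring.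
Qed.

Lemma intg_supported (f : R -> R) (a b : R) :
  cont f -> (forall x, 0 <= f x) -> a <= b -> (forall x, x <= a \/ b <= x -> f x = 0) ->
  intg f (RInt f a b).
Proof.
  intros Hf Hp Hab H0.
  assert (Z : forall u v, u <= v -> (v <= a \/ b <= u) -> RInt f u v = 0).
  { intros u v Huv D. rewrite (RInt_ext f (fun _ => 0)).
    - rewrite RInt_constant. apply Rmult_0_r.
    - intros x. rewrite Rmin_left, Rmax_right by lra. intros X. apply H0. lra. }
  apply intg_intro; auto.
  - intros u v Huv.
    assert (M1 := Rmin_l u a). assert (M2 := Rmin_r u a).
    assert (M3 := Rmax_l v b). assert (M4 := Rmax_r v b).
    assert (C := RInt_incl f u v (Rmin u a) (Rmax v b) Hf Hp).
    rewrite (RInt_split f (Rmin u a) a (Rmax v b)) in C by auto.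
    rewrite (RInt_split f a b (Rmax v b)) in C by auto.
    rewrite (Z (Rmin u a) a), (Z b (Rmax v b)) in C by lra. lra.
  - intros eps He. exists a, b. split; auto. lra.
Qed.

(** Since [intg] is used for nonnegative functions only, signed combinations are treated as limits
    along [-n, n]. *)
Lemma intg_is_lim_seq (f : R -> R) (l : R) :
  cont f -> (forall x, 0 <= f x) -> intg f l ->
  is_lim_seq (fun n => RInt f (- INR n) (INR n)) l.
Proof.
  intros Hf Hp [H1 H2]. apply is_lim_seq_spec. intros eps.
  destruct (H2 eps (cond_pos eps)) as (A & HA & B).
  destruct (nfloor_ex A) as [N [_ HN]]; [lra|].
  exists (S N). intros n Hn. apply le_INR in Hn. rewrite S_INR in Hn.
  assert (C := RInt_incl f (- A) A (- INR n) (INR n) Hf Hp).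
  assert (D := H1 (- INR n) (INR n)).
  apply Rabs_def1; lra.
Qed.

Lemma is_RInt_R_intg (f : R -> R) (l : R) :
  cont f -> (forall x, 0 <= f x) -> is_RInt_R f l <-> intg f l.
Proof.
  intros Hf Hp. split.
  - intros [pr H]. apply intg_intro; auto.
    + intros a b Hab. apply Rnot_lt_le. intros L.
      destruct (H (RInt f a b - l)) as [A HA]; [lra|].
      assert (M1 := Rmin_l (- A) a). assert (M2 := Rmin_r (- A) a).
      assert (M3 := Rmax_l A b). assert (M4 := Rmax_r A b).
      assert (C := RInt_incl f a b (Rmin (- A) a) (Rmax A b) Hf Hp M2 Hab M4).
      specialize (HA (Rmin (- A) a) (Rmax A b) M1 M3).
      rewrite <- RInt_Reals in HA. apply Rabs_def2 in HA. lra.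
    + intros eps He. destruct (H eps He) as [A HA].
      (* The threshold [A] of [is_RInt_R] may be negative. *)
      exists (- Rabs A), (Rabs A). assert (A1 := Rabs_pos A). assert (A2 := Rle_abs A).
      split; [lra|].
      assert (B1 : - Rabs A <= - A) by lra. specialize (HA _ _ B1 A2).
      rewrite <- RInt_Reals in HA. apply Rabs_def2 in HA. lra.
  - intros [H1 H2].
    exists (fun a b => ex_RInt_Reals_0 f a b (cont_ex_RInt f a b Hf)).
    intros eps He. destruct (H2 eps He) as (A & HA & B). exists A.
    intros a b Ha Hb. rewrite <- RInt_Reals.
    assert (C := RInt_incl f (- A) A a b Hf Hp Ha). assert (D := H1 a b).
    apply Rabs_def1; lra.
Qed.

Lemma RInt_R_eq (f : R -> R) (l : R) :
  cont f -> (forall x, 0 <= f x) -> intg f l -> RInt_R f = l.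
Proof.
  intros Hf Hp H. apply (intg_unique f); [|exact H].
  apply is_RInt_R_intg; auto. unfold RInt_R. apply epsilon_spec.
  exists l. now apply is_RInt_R_intg.
Qed.

(* No regularity of g is needed: both sides are the epsilon-choice of the same predicate. *)
Lemma RInt_R_reflect (s : R) (g : R -> R) : RInt_R (fun x => g (s - x)) = RInt_R g.
Proof.
  assert (W : forall g l, is_RInt_R g l -> is_RInt_R (fun x => g (s - x)) l).
  { clear g. intros g l [pr H].
    assert (E : forall a b, is_RInt (fun x => g (s - x)) a b (RInt g (s - b) (s - a))).
    { intros a b.
      assert (X : is_RInt g (-1 * a + s) (-1 * b + s) (RInt g (s - a) (s - b))).
      { replace (-1 * a + s) with (s - a) by ring. replace (-1 * b + s) with (s - b) by ring.
        apply (RInt_correct (V := R_CompleteNormedModule)), ex_RInt_Reals_1, pr. }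
      apply (is_RInt_comp_lin g (-1) s a b) in X.
      apply (is_RInt_scal _ _ _ (-1)) in X.
      assert (V : scal (-1) (RInt g (s - a) (s - b)) = RInt g (s - b) (s - a)).
      { rewrite <- (opp_RInt_swap (V := R_CompleteNormedModule) g (s - a) (s - b))
          by (apply ex_RInt_Reals_1, pr).
        unfold scal, opp; simpl. unfold mult; simpl. ring. }
      rewrite <- V. eapply is_RInt_ext; [|exact X].
      intros x _. unfold scal; simpl. unfold mult; simpl.
      replace (-1 * x + s) with (s - x) by ring. ring. }
    assert (P : forall a b, Riemann_integrable (fun x => g (s - x)) a b).
    { intros a b. apply ex_RInt_Reals_0. eexists. apply E. }
    exists P. intros eps He. destruct (H eps He) as [A HA]. exists (A + Rabs s).
    intros a b Ha Hb. assert (S1 := Rle_abs s).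
    assert (S2 := Rle_abs (- s)). rewrite Rabs_Ropp in S2.
    rewrite <- RInt_Reals, (is_RInt_unique _ _ _ _ (E a b)).
    rewrite (RInt_Reals _ _ _ (pr (s - b) (s - a))). apply HA; lra. }
  unfold RInt_R. f_equal. apply functional_extensionality. intros l.
  apply propositional_extensionality. split; [|apply W].
  intros H. apply W in H. replace g with (fun x => g (s - (s - x))); [exact H|].
  apply functional_extensionality. intros x. f_equal. ring.
Qed.

Lemma intg_RInt_R (f : R -> R) :
  cont f -> (forall x, 0 <= f x) -> (exists l, intg f l) -> intg f (RInt_R f).
Proof. intros Hf Hp [l H]. now rewrite (RInt_R_eq f l). Qed.

(** * Parametric integrals and Tonelli's theorem *)

Lemma choice_fun {A : Type} (P : R -> A -> Prop) :
  (forall x, exists v, P x v) -> exists F, forall x, P x (F x).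
Proof.
  intros H. exists (fun x => proj1_sig (constructive_indefinite_description _ (H x))).
  intros x. apply proj2_sig.
Qed.

Lemma continuous_eps {T : UniformSpace} (f : T -> R) (x : T) :
  continuous f x <->
  forall eps, 0 < eps -> exists d : posreal, forall t, ball x d t -> Rabs (f t - f x) < eps.
Proof.
  split.
  - intros H eps He. destruct (H (ball (f x) (mkposreal eps He)) (locally_ball _ _)) as [d Hd].
    exists d. exact Hd.
  - intros H P [e He]. destruct (H e (cond_pos e)) as [d Hd].
    exists d. intros t Ht. apply He, (Hd t Ht).
Qed.

(** Tube lemma: joint continuity at each (t0, x) gives a radius depending on x, and compactness of
    [a, b] gives one that serves for all x. *)
Lemma jcont_locally_uniform {T : UniformSpace} (G : T -> R -> R) (t0 : T) (a b eps : R) :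
  jcont G -> 0 < eps ->
  exists d : posreal, forall t, ball t0 d t -> forall x, a <= x <= b ->
    Rabs (G t x - G t0 x) < eps.
Proof.
  intros HG He.
  assert (H : forall x, exists d : posreal, forall z : T * R,
             ball (t0, x) d z -> Rabs (G (fst z) (snd z) - G t0 x) < eps / 2).
  { intros x. apply (proj1 (continuous_eps _ _) (HG (t0, x)) (eps / 2)). lra. }
  apply choice_fun in H. destruct H as [delta Hdelta].
  destruct (compactness_value_1d a b delta) as [d Hd].
  (* [compactness_value_1d] yields its centre only under a double negation, so the goal is negated
     first. *)
  exists d. intros t Ht x Hx. apply NNPP. intros N. apply (Hd x Hx).
  intros (s & _ & Hs1 & Hs2). apply N.
  assert (A1 := Hdelta s (t, x)). assert (A2 := Hdelta s (t0, x)). simpl in A1, A2.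
  assert (B1 : Rabs (G t x - G t0 s) < eps / 2).
  { apply A1. split; [exact (ball_le _ _ _ Hs2 _ Ht)|exact Hs1]. }
  assert (B2 : Rabs (G t0 x - G t0 s) < eps / 2).
  { apply A2. split; [apply ball_center|exact Hs1]. }
  apply Rabs_def2 in B1. apply Rabs_def2 in B2. apply Rabs_def1; lra.
Qed.

Lemma jcont_slice {T : UniformSpace} (G : T -> R -> R) (t : T) : jcont G -> cont (G t).
Proof.
  intros H x. apply (cont_comp2 G (fun _ => t) (fun x => x) x H);
    [apply continuous_const|apply continuous_id].
Qed.

Lemma jcont_slice_l {T : UniformSpace} (G : T -> R -> R) (x : R) : jcont G -> cont (fun t => G t x).
Proof.
  intros H t. apply (cont_comp2 G (fun t => t) (fun _ => x) t H);
    [apply continuous_id|apply continuous_const].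
Qed.

Lemma jcont_swap (G : R -> R -> R) : jcont G -> jcont (fun x y => G y x).
Proof. intros H. ctn. Qed.

Lemma cont_RInt_param {T : UniformSpace} (G : T -> R -> R) (a b : R) :
  jcont G -> a <= b -> cont (fun t => RInt (G t) a b).
Proof.
  intros HG Hab t0. apply continuous_eps. intros eps He.
  (* The added 1 keeps the denominator positive when a = b. *)
  destruct (jcont_locally_uniform G t0 a b (eps / (b - a + 1)) HG) as [d Hd];
    [apply Rdiv_lt_0_compat; lra|].
  exists d. intros t Ht.
  assert (C1 := jcont_slice G t HG). assert (C2 := jcont_slice G t0 HG).
  assert (E : RInt (G t) a b - RInt (G t0) a b = RInt (fun x => G t x - G t0 x) a b).
  { symmetry. apply (RInt_minus (V := R_CompleteNormedModule) (G t) (G t0));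
      now apply cont_ex_RInt. }
  rewrite E. apply Rle_lt_trans with ((b - a) * (eps / (b - a + 1))).
  - apply abs_RInt_le_const; auto.
    + apply cont_ex_RInt. ctn.
    + intros x Hx. apply Rlt_le, Hd; auto.
  - replace ((b - a) * (eps / (b - a + 1))) with (eps - eps / (b - a + 1)) by (field; lra).
    assert (0 < eps / (b - a + 1)) by (apply Rdiv_lt_0_compat; lra). lra.
Qed.

Lemma is_derive_RInt_upper (f : R -> R) (a x : R) :
  cont f -> is_derive (fun u => RInt f a u) x (f x).
Proof.
  intros Hf. apply (is_derive_RInt (V := R_NormedModule) f (fun u => RInt f a u) a x); [|apply Hf].
  exists (mkposreal 1 Rlt_0_1). intros u _.
  apply (RInt_correct (V := R_CompleteNormedModule)), cont_ex_RInt, Hf.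
Qed.

Lemma jcont_continuity_2d (G : R -> R -> R) (x y : R) : jcont G -> continuity_2d_pt G x y.
Proof. intros H. apply continuity_2d_pt_filterlim. apply (H (x, y)). Qed.

Lemma cont_RInt_param_gen {T : UniformSpace} (G : T -> R -> R) (a b : R) :
  jcont G -> cont (fun t => RInt (G t) a b).
Proof.
  intros HG. destruct (Rle_dec a b) as [H|H]; [now apply cont_RInt_param|].
  assert (E : (fun t => RInt (G t) a b) = (fun t => - RInt (G t) b a)).
  { apply functional_extensionality. intros t. symmetry.
    apply (opp_RInt_swap (V := R_CompleteNormedModule)), cont_ex_RInt. now apply jcont_slice. }
  rewrite E. intros t. apply cont_opp. apply cont_RInt_param; auto; lra.
Qed.

(** As functions of the endpoint b, both sides vanish at a and have the same derivative, by the
    fundamental theorem on the left and differentiation under the integral on the right. *)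
Lemma fubini_rectangle (G : R -> R -> R) (a b c d : R) :
  jcont G -> RInt (fun x => RInt (G x) c d) a b = RInt (fun y => RInt (fun x => G x y) a b) c d.
Proof.
  intros HG. assert (HG' := jcont_swap G HG).
  assert (D1 : forall u, is_derive (fun u => RInt (fun x => RInt (G x) c d) a u) u (RInt (G u) c d)).
  { intros u. apply (is_derive_RInt_upper (fun x => RInt (G x) c d)).
    now apply cont_RInt_param_gen. }
  assert (DD : forall u y, is_derive (fun u => RInt (fun x => G x y) a u) u (G u y)).
  { intros u y. apply (is_derive_RInt_upper (fun x => G x y)). now apply jcont_slice_l. }
  assert (DE : forall u y, Derive (fun u => RInt (fun x => G x y) a u) u = G u y).
  { intros u y. apply is_derive_unique, DD. }
  assert (D2 : forall u, is_derive (fun u => RInt (fun y => RInt (fun x => G x y) a u) c d) u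
                          (RInt (G u) c d)).
  { intros u.
    replace (RInt (G u) c d) with
      (RInt (fun y => Derive (fun u => RInt (fun x => G x y) a u) u) c d)
      by (apply RInt_ext; intros y _; apply DE).
    apply (is_derive_RInt_param (fun u y => RInt (fun x => G x y) a u)).
    - exists (mkposreal 1 Rlt_0_1). intros v _ y _. eexists. apply DD.
    - intros y _. apply continuity_2d_pt_ext with G; [intros; symmetry; apply DE|].
      now apply jcont_continuity_2d.
    - exists (mkposreal 1 Rlt_0_1). intros v _.
      apply cont_ex_RInt, (cont_RInt_param_gen (fun y x => G x y)), HG'. }
  set (F := fun u => RInt (fun x => RInt (G x) c d) a u
                     - RInt (fun y => RInt (fun x => G x y) a u) c d).
  assert (DF : forall u, is_derive F u 0).
  { intros u. rewrite <- (Rminus_diag (RInt (G u) c d)).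
    apply (is_derive_minus (V := R_NormedModule)
             (fun u => RInt (fun x => RInt (G x) c d) a u)); auto. }
  assert (F0 : F a = 0).
  { unfold F. rewrite RInt_point.
    rewrite (RInt_ext _ (fun _ => 0)).
    - rewrite RInt_constant, Rmult_0_r. apply Rminus_diag.
    - intros y _. now rewrite RInt_point. }
  assert (Fb : F b = F a).
  { destruct (Rtotal_order a b) as [H|[->|H]]; auto.
    - symmetry. apply (eq_is_derive (V := R_NormedModule)); auto.
    - apply (eq_is_derive (V := R_NormedModule)); auto. }
  rewrite F0 in Fb. unfold F in Fb. lra.
Qed.

(* Dini's theorem for the truncations [RInt (G y) (-A) A]. The local bound on A is
   turned into a uniform one by letting the gauge be at most 1/A. *)
Lemma dini (G : R -> R -> R) (I : R -> R) (a b eps : R) :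
  jcont G -> (forall y x, 0 <= G y x) -> (forall y, intg (G y) (I y)) -> cont I -> 0 < eps ->
  exists A, 0 < A /\ forall y, a <= y <= b -> I y - eps < RInt (G y) (- A) A.
Proof.
  intros HG Hp HI CI He.
  assert (H : forall y0, exists d : posreal, forall y, Rabs (y - y0) < d ->
             I y - eps < RInt (G y) (- / d) (/ d)).
  { intros y0. destruct (proj2 (HI y0) (eps / 2)) as (A & HA & B); [lra|].
    assert (C : cont (fun y => RInt (G y) (- A) A - I y)).
    { assert (C1 := cont_RInt_param_gen G (- A) A HG). intros y.
      apply (cont_sub (fun y => RInt (G y) (- A) A) I); auto. }
    destruct (proj1 (continuous_eps _ _) (C y0) (eps / 2)) as [d Hd]; [lra|].
    assert (M : 0 < Rmin d (/ A)).
    { apply Rmin_glb_lt; [apply cond_pos|now apply Rinv_0_lt_compat]. }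
    exists (mkposreal _ M). simpl. intros y Hy.
    assert (M1 := Rmin_l d (/ A)). assert (M2 := Rmin_r d (/ A)).
    assert (K : A <= / Rmin d (/ A)).
    { rewrite <- (Rinv_inv A) at 1. now apply Rinv_le_contravar. }
    assert (L := RInt_incl (G y) (- A) A (- / Rmin d (/ A)) (/ Rmin d (/ A))
                   (jcont_slice G y HG) (Hp y)).
    assert (N : Rabs (RInt (G y) (- A) A - I y - (RInt (G y0) (- A) A - I y0)) < eps / 2).
    { apply Hd. apply Rlt_le_trans with (1 := Hy). exact M1. }
    apply Rabs_def2 in N. lra. }
  apply choice_fun in H. destruct H as [delta Hdelta].
  destruct (compactness_value_1d a b delta) as [d Hd].
  exists (/ d). split; [apply Rinv_0_lt_compat, cond_pos|].
  intros y Hy. apply NNPP. intros N. apply (Hd y Hy). intros (s & _ & H1 & H2). apply N.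
  eapply Rlt_le_trans; [exact (Hdelta s y H1)|].
  assert (K : / delta s <= / d) by (apply Rinv_le_contravar; [apply cond_pos|exact H2]).
  assert (0 < / delta s) by apply Rinv_0_lt_compat, cond_pos.
  apply RInt_incl; auto; first [now apply jcont_slice | lra].
Qed.

(** Fubini on rectangles bounds every truncation from above; Dini's uniform cut-off shows that the
    truncations come arbitrarily close. *)
Lemma tonelli_strip (G : R -> R -> R) (I : R -> R) (a b : R) :
  jcont G -> (forall y x, 0 <= G y x) -> (forall y, intg (G y) (I y)) -> cont I -> a <= b ->
  intg (fun x => RInt (fun y => G y x) a b) (RInt I a b).
Proof.
  intros HG Hp HI CI Hab.
  assert (C : forall u v, cont (fun y => RInt (G y) u v)) by (intros; now apply cont_RInt_param_gen).
  apply intg_intro.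
  - apply (cont_RInt_param_gen (fun x y => G y x)). now apply jcont_swap.
  - intros x. apply RInt_nonneg; auto. now apply jcont_slice_l.
  - intros u v Huv. rewrite <- (fubini_rectangle G a b u v HG).
    apply RInt_mono; auto. intros y _. now apply (proj1 (HI y)).
  - intros eps He.
    destruct (dini G I a b (eps / (b - a + 1)) HG Hp HI CI) as (A & HA & B);
      [apply Rdiv_lt_0_compat; lra|].
    exists (- A), A. split; [lra|]. rewrite <- (fubini_rectangle G a b _ _ HG).
    apply Rlt_le_trans with (RInt I a b - (b - a) * (eps / (b - a + 1))).
    + replace ((b - a) * (eps / (b - a + 1))) with (eps - eps / (b - a + 1)) by (field; lra).
      assert (0 < eps / (b - a + 1)) by (apply Rdiv_lt_0_compat; lra). lra.
    + assert (D : RInt (fun y => I y + - (eps / (b - a + 1))) a b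
                  <= RInt (fun y => RInt (G y) (- A) A) a b).
      { apply RInt_mono; auto; [ctn|]. intros y Hy. specialize (B y Hy). lra. }
      rewrite RInt_add, RInt_constant in D by ctn. lra.
Qed.

(** Both bounds reduce to strips: a bounded piece of J is the integral of a partial integral of G,
    hence at most that of I, and conversely I is first truncated to a bounded interval. *)
Lemma tonelli (G : R -> R -> R) (I J : R -> R) (l : R) :
  jcont G -> (forall y x, 0 <= G y x) ->
  (forall y, intg (G y) (I y)) -> cont I ->
  (forall x, intg (fun y => G y x) (J x)) -> cont J ->
  intg I l -> intg J l.
Proof.
  intros HG Hp HI CI HJ CJ Hl. assert (HG' := jcont_swap G HG).
  assert (I0 : forall y, 0 <= I y) by (intros; now apply intg_nonneg with (G y)).
  assert (J0 : forall y, 0 <= J y) by (intros; now apply intg_nonneg with (fun x => G x y)).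
  apply intg_intro; auto.
  - intros a b Hab.
    assert (S := tonelli_strip (fun x y => G y x) J a b HG' (fun x y => Hp y x) HJ CJ Hab).
    simpl in S. refine (intg_mono _ I _ l _ CI _ S Hl).
    + now apply (cont_RInt_param_gen G).
    + intros y. now apply (proj1 (HI y)).
  - intros eps He. destruct (proj2 Hl (eps / 2)) as (A & HA & B); [lra|].
    assert (Hab : - A <= A) by lra.
    assert (S := tonelli_strip G I (- A) A HG Hp HI CI Hab).
    destruct (proj2 S (eps / 2)) as (D & HD & E); [lra|].
    exists (- D), D. split; [lra|].
    eapply Rlt_le_trans with (RInt (fun x => RInt (fun y => G y x) (- A) A) (- D) D); [lra|].
    apply RInt_mono; auto; [|intros x _; now apply (proj1 (HJ x))|lra].
    now apply (cont_RInt_param_gen (fun x y => G y x)).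
Qed.

(** The tails of all G t are at most the tail of D, so I is uniformly close to its truncation, which
    is continuous. *)
Lemma dominated_cont {T : UniformSpace} (G : T -> R -> R) (D : R -> R) (l : R) (I : T -> R) :
  jcont G -> cont D -> (forall t x, 0 <= G t x <= D x) -> intg D l ->
  (forall t, intg (G t) (I t)) -> cont I.
Proof.
  intros HG CD Hb HD HI t0. apply continuous_eps. intros eps He.
  destruct (proj2 HD (eps / 4)) as (A & HA & B); [lra|].
  assert (Tail : forall t, RInt (G t) (- A) A <= I t <= RInt (G t) (- A) A + eps / 4).
  { intros t. split; [apply (proj1 (HI t)); lra|].
    apply Rnot_lt_le. intros L.
    destruct (proj2 (HI t) (I t - RInt (G t) (- A) A - eps / 4)) as (A' & HA' & B'); [lra|].
    set (M := Rmax A A'). assert (M1 := Rmax_l A A'). assert (M2 := Rmax_r A A').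
    fold M in M1, M2. assert (C := jcont_slice G t HG).
    assert (P : forall x, 0 <= G t x) by (intros; apply Hb).
    assert (U := RInt_incl (G t) (- A') A' (- M) M C P).
    assert (V := proj1 HD (- M) M).
    rewrite (RInt_split (G t) (- M) (- A) M), (RInt_split (G t) (- A) A M) in U by auto.
    rewrite (RInt_split D (- M) (- A) M), (RInt_split D (- A) A M) in V by auto.
    assert (W1 := RInt_mono (G t) D (- M) (- A) C CD (fun x _ => proj2 (Hb t x))).
    assert (W2 := RInt_mono (G t) D A M C CD (fun x _ => proj2 (Hb t x))).
    lra. }
  assert (C := cont_RInt_param_gen G (- A) A HG).
  destruct (proj1 (continuous_eps _ _) (C t0) (eps / 4)) as [d Hd]; [lra|].
  exists d. intros t Ht. specialize (Hd t Ht). apply Rabs_def2 in Hd.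
  assert (T1 := Tail t). assert (T2 := Tail t0). apply Rabs_def1; lra.
Qed.

(** * The Theta-chain and its reversibility *)

(* [phi x = f1 (y - x)] is the likelihood of X = x, [f] the density of Z2. *)
Record flat_model (phi f c : R -> R) (B Z : R) : Prop := {
  phi_cont : cont phi;
  phi_pos : forall x, 0 < phi x;
  phi_intg : intg phi 1;
  noise_cont : cont f;
  noise_pos : forall x, 0 < f x;
  noise_le : forall x, f x <= B;
  noise_intg : intg f 1;
  marg_intg : forall t, intg (fun x => phi x * f (x - t)) (c t);
  total_intg : intg c Z
}.

(* The transition density of the Theta-chain is [overlap phi f t s / c t]. *)
Definition overlap (phi f : R -> R) (t s : R) : R :=
  RInt_R (fun x => phi x * f (x - t) * f (x - s)).

Lemma noise_bound_pos phi f c B Z : flat_model phi f c B Z -> 0 < B.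
Proof.
  intros M. assert (H := noise_le _ _ _ _ _ M 0). assert (K := noise_pos _ _ _ _ _ M 0). lra.
Qed.

(** Stated without [flat_model], because continuity of c is used in building that record. *)
Lemma correlation_cont (phi f c : R -> R) (B : R) :
  cont phi -> (forall x, 0 < phi x) -> intg phi 1 ->
  cont f -> (forall x, 0 < f x) -> (forall x, f x <= B) ->
  (forall t, intg (fun x => phi x * f (x - t)) (c t)) -> cont c.
Proof.
  intros Hp Pp Ip Hf Pf Bf Hc.
  apply (dominated_cont (fun t x => phi x * f (x - t)) (fun x => B * phi x) (B * 1)); auto.
  - ctn.
  - ctn.
  - intros t x. assert (P := Pp x). assert (Q := Pf (x - t)). assert (R := Bf (x - t)). nra.
  - apply intg_scal; auto. assert (Q := Pf 0). assert (R := Bf 0). lra.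
Qed.

Lemma marg_cont phi f c B Z : flat_model phi f c B Z -> cont c.
Proof. intros M. destruct M. now apply (correlation_cont phi f c B). Qed.

Lemma marg_pos phi f c B Z : flat_model phi f c B Z -> forall t, 0 < c t.
Proof.
  intros M t. destruct M.
  apply Rlt_le_trans with (RInt (fun x => phi x * f (x - t)) 0 1).
  - apply RInt_gt_0; [lra| |].
    + intros x _. now apply Rmult_lt_0_compat.
    + intros x _. ctn.
  - apply (proj1 (marg_intg0 t)). lra.
Qed.

Lemma total_pos phi f c B Z : flat_model phi f c B Z -> 0 < Z.
Proof.
  intros M. assert (P := marg_pos _ _ _ _ _ M). assert (C := marg_cont _ _ _ _ _ M).
  apply Rlt_le_trans with (RInt c 0 1).
  - apply RInt_gt_0; [lra|auto|]. intros x _. apply C.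
  - apply (proj1 (total_intg _ _ _ _ _ M)). lra.
Qed.

(** This is detailed balance: c(t) times the transition density from t to s is
    [overlap phi f t s]. *)
Lemma overlap_sym phi f t s : overlap phi f t s = overlap phi f s t.
Proof.
  unfold overlap. f_equal. apply functional_extensionality. intros x. ring.
Qed.

Lemma overlap_intg phi f c B Z : flat_model phi f c B Z ->
  forall t s, intg (fun x => phi x * f (x - t) * f (x - s)) (overlap phi f t s).
Proof.
  intros M t s. assert (BP := noise_bound_pos _ _ _ _ _ M). destruct M.
  assert (C : cont (fun x => phi x * f (x - t) * f (x - s))) by ctn.
  assert (P : forall x, 0 <= phi x * f (x - t) * f (x - s)).
  { intros x. repeat apply Rmult_le_pos; now apply Rlt_le. }
  apply intg_RInt_R; auto.
  apply (intg_dominated _ (fun x => B * (phi x * f (x - t))) (B * c t)); auto.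
  - ctn.
  - intros x. split; auto. rewrite Rmult_comm. apply Rmult_le_compat_r; auto.
    apply Rmult_le_pos; now apply Rlt_le.
  - apply (intg_scal B (fun x => phi x * f (x - t))); auto; [ctn|lra].
Qed.

Lemma overlap_nonneg phi f c B Z : flat_model phi f c B Z -> forall t s, 0 <= overlap phi f t s.
Proof. intros M t s. exact (intg_nonneg _ _ (overlap_intg _ _ _ _ _ M t s)). Qed.

(** One noise factor is bounded by B. With the symmetry this bounds the density of the first step by
    (B / c t0) c. *)
Lemma overlap_le phi f c B Z : flat_model phi f c B Z ->
  forall t s, overlap phi f t s <= B * c t.
Proof.
  intros M t s. assert (BP := noise_bound_pos _ _ _ _ _ M).
  assert (O := overlap_intg _ _ _ _ _ M t s). destruct M.
  refine (intg_mono _ (fun x => B * (phi x * f (x - t))) _ _ _ _ _ O _).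
  - ctn.
  - ctn.
  - intros x. rewrite Rmult_comm. apply Rmult_le_compat_r; auto.
    apply Rmult_le_pos; now apply Rlt_le.
  - apply (intg_scal B (fun x => phi x * f (x - t))); auto; [ctn|lra].
Qed.

Lemma overlap_jcont phi f c B Z : flat_model phi f c B Z -> jcont (overlap phi f).
Proof.
  intros M. assert (BP := noise_bound_pos _ _ _ _ _ M).
  assert (O := overlap_intg _ _ _ _ _ M). destruct M.
  apply (dominated_cont (T := prod_UniformSpace R_UniformSpace R_UniformSpace)
    (fun z x => phi x * f (x - fst z) * f (x - snd z)) (fun x => (B * B) * phi x) (B * B * 1)).
  - ctn.
  - ctn.
  - intros z x. split.
    + repeat apply Rmult_le_pos; now apply Rlt_le.
    + rewrite (Rmult_comm (B * B)), Rmult_assoc. apply Rmult_le_compat_l; [now apply Rlt_le|].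
      apply Rmult_le_compat; auto; now apply Rlt_le.
  - apply intg_scal; auto. nra.
  - intros z. apply O.
Qed.

(** Integrating s out first leaves the factor 1 from f(x - s). So the kernel has mass 1 and, by
    symmetry, c is invariant. *)
Lemma overlap_marginal phi f c B Z : flat_model phi f c B Z -> forall t, intg (overlap phi f t) (c t).
Proof.
  intros M t. assert (O := overlap_intg _ _ _ _ _ M). assert (J := overlap_jcont _ _ _ _ _ M).
  destruct M.
  apply (tonelli (fun x s => phi x * f (x - t) * f (x - s)) (fun x => phi x * f (x - t))).
  - ctn.
  - intros x s. repeat apply Rmult_le_pos; now apply Rlt_le.
  - intros x.
    assert (E : intg (fun s => phi x * f (x - t) * f (x - s)) (phi x * f (x - t) * 1)).
    { apply (intg_scal _ (fun s => f (x - s))).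
      - ctn.
      - apply Rmult_le_pos; now apply Rlt_le.
      - apply intg_reflect; auto. intros; now apply Rlt_le. }
    now rewrite Rmult_1_r in E.
  - ctn.
  - intros s. apply O.
  - now apply jcont_slice.
  - apply marg_intg0.
Qed.

(** The class on which [step] and [form] are genuine integrals; [step] preserves it with the same
    U. *)
Definition dominated (c : R -> R) (U : R) (p : R -> R) : Prop :=
  cont p /\ forall t, 0 <= p t <= U * c t.

Definition step (phi f c p : R -> R) (s : R) : R :=
  RInt_R (fun t => p t * (overlap phi f t s / c t)).

(* The inner product of [p/c] and [q/c] in L^2(c). *)
Definition form (c p q : R -> R) : R := RInt_R (fun t => p t * q t / c t).

Lemma div_pos_ne (c : R -> R) : (forall t, 0 < c t) -> forall t, c t <> 0.
Proof. intros H t. apply Rgt_not_eq, H. Qed.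

Lemma step_intg phi f c B Z U p : flat_model phi f c B Z -> dominated c U p ->
  forall s, intg (fun t => p t * (overlap phi f t s / c t)) (step phi f c p s).
Proof.
  intros M [Cp Hp] s. assert (O := overlap_nonneg _ _ _ _ _ M).
  assert (J := overlap_jcont _ _ _ _ _ M). assert (P := marg_pos _ _ _ _ _ M).
  assert (C := marg_cont _ _ _ _ _ M). assert (N := div_pos_ne c P).
  assert (K := overlap_marginal _ _ _ _ _ M s).
  assert (D : cont (fun t => p t * (overlap phi f t s / c t))) by (ctn; auto).
  assert (E : forall t, 0 <= p t * (overlap phi f t s / c t) <= U * overlap phi f s t).
  { intros t. assert (Q : 0 <= overlap phi f t s / c t).
    { apply Rmult_le_pos; [apply O|]. now apply Rlt_le, Rinv_0_lt_compat. }
    split; [apply Rmult_le_pos; auto; apply Hp|].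
    replace (U * overlap phi f s t) with (U * c t * (overlap phi f t s / c t)).
    - apply Rmult_le_compat_r; auto. apply Hp.
    - rewrite (overlap_sym _ _ t s). field. apply N. }
  assert (U0 : 0 <= U).
  { assert (A := Hp 0). assert (A' := P 0). nra. }
  apply intg_RInt_R; [exact D|intros t; apply E|].
  apply (intg_dominated _ (fun t => U * overlap phi f s t) (U * c s) D); auto.
  - assert (cont (overlap phi f s)) by now apply jcont_slice. ctn.
  - apply (intg_scal U (overlap phi f s)); auto. now apply jcont_slice.
Qed.

(** A maximum principle: p <= U c gives a bound by U times the step of c, which is c again. *)
Lemma step_dominated phi f c B Z U p : flat_model phi f c B Z -> dominated c U p ->
  dominated c U (step phi f c p).
Proof.
  intros M Hd. assert (SI := step_intg _ _ _ _ _ _ _ M Hd). destruct Hd as [Cp Hp].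
  assert (O := overlap_nonneg _ _ _ _ _ M). assert (OL := overlap_le _ _ _ _ _ M).
  assert (J := overlap_jcont _ _ _ _ _ M). assert (P := marg_pos _ _ _ _ _ M).
  assert (C := marg_cont _ _ _ _ _ M). assert (N := div_pos_ne c P).
  assert (BP := noise_bound_pos _ _ _ _ _ M).
  assert (U0 : 0 <= U).
  { assert (A := Hp 0). assert (A' := P 0). nra. }
  assert (Q : forall t s, 0 <= overlap phi f t s / c t).
  { intros t s. apply Rmult_le_pos; [apply O|]. now apply Rlt_le, Rinv_0_lt_compat. }
  assert (E : forall t s, p t * (overlap phi f t s / c t) <= U * overlap phi f t s).
  { intros t s. replace (U * overlap phi f t s) with (U * c t * (overlap phi f t s / c t)).
    - apply Rmult_le_compat_r; auto. apply Hp.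
    - field. apply N. }
  assert (GJ : jcont (fun s t => p t * (overlap phi f t s / c t))) by (ctn; auto).
  split.
  - apply (dominated_cont (fun s t => p t * (overlap phi f t s / c t))
             (fun t => (U * B) * c t) (U * B * Z)); auto.
    + ctn.
    + intros s t. split; [apply Rmult_le_pos; auto; apply Hp|].
      eapply Rle_trans; [apply E|]. rewrite Rmult_assoc. now apply Rmult_le_compat_l.
    + apply intg_scal; auto; [nra|]. exact (total_intg _ _ _ _ _ M).
  - intros s. split; [exact (intg_nonneg _ _ (SI s))|].
    refine (intg_mono _ (fun t => U * overlap phi f s t) _ _ _ _ _ (SI s) _).
    + exact (jcont_slice _ s GJ).
    + assert (cont (overlap phi f s)) by now apply jcont_slice. ctn.
    + intros t. rewrite (overlap_sym _ _ s t). apply E.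
    + apply (intg_scal U (overlap phi f s)); auto; [now apply jcont_slice|].
      exact (overlap_marginal _ _ _ _ _ M s).
Qed.

Lemma form_intg phi f c B Z U V p q : flat_model phi f c B Z ->
  dominated c U p -> dominated c V q -> intg (fun t => p t * q t / c t) (form c p q).
Proof.
  intros M [Cp Hp] [Cq Hq]. assert (P := marg_pos _ _ _ _ _ M).
  assert (C := marg_cont _ _ _ _ _ M). assert (N := div_pos_ne c P).
  assert (D : cont (fun t => p t * q t / c t)) by (ctn; auto).
  assert (E : forall t, 0 <= p t * q t / c t <= (U * V) * c t).
  { intros t. assert (I := Rinv_0_lt_compat _ (P t)). split.
    - apply Rmult_le_pos; [apply Rmult_le_pos; [apply Hp|apply Hq]|lra].
    - replace (U * V * c t) with ((U * c t) * (V * c t) / c t) by (field; apply N).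
      apply Rmult_le_compat_r; [lra|]. apply Rmult_le_compat; first [apply Hp|apply Hq]. }
  assert (U0 : 0 <= U).
  { assert (A := Hp 0). assert (A' := P 0). nra. }
  assert (V0 : 0 <= V).
  { assert (A := Hq 0). assert (A' := P 0). nra. }
  apply intg_RInt_R; [exact D|intros t; apply E|].
  apply (intg_dominated _ (fun t => (U * V) * c t) (U * V * Z) D); auto.
  - ctn.
  - apply intg_scal; auto; [nra|]. exact (total_intg _ _ _ _ _ M).
Qed.

(** Self-adjointness: both sides are iterated integrals of the kernel p(t)/c(t) * overlap(t,s) *
    q(s)/c(s), taken in the two orders. *)
Lemma form_step phi f c B Z U V p q : flat_model phi f c B Z ->
  dominated c U p -> dominated c V q -> form c (step phi f c p) q = form c p (step phi f c q).
Proof.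
  intros M Hp Hq.
  assert (Sp := step_dominated _ _ _ _ _ _ _ M Hp). assert (Sq := step_dominated _ _ _ _ _ _ _ M Hq).
  assert (F1 := form_intg _ _ _ _ _ _ _ _ _ M Sp Hq).
  assert (F2 := form_intg _ _ _ _ _ _ _ _ _ M Hp Sq).
  assert (I1 := step_intg _ _ _ _ _ _ _ M Hp). assert (I2 := step_intg _ _ _ _ _ _ _ M Hq).
  assert (P := marg_pos _ _ _ _ _ M). assert (N := div_pos_ne c P).
  assert (C := marg_cont _ _ _ _ _ M). assert (J := overlap_jcont _ _ _ _ _ M).
  destruct Hp as [Cp Hp], Hq as [Cq Hq], Sp as [CSp HSp], Sq as [CSq HSq].
  assert (Pp : forall t, 0 <= p t / c t).
  { intros t. apply Rmult_le_pos; [apply Hp|]. now apply Rlt_le, Rinv_0_lt_compat. }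
  assert (Pq : forall t, 0 <= q t / c t).
  { intros t. apply Rmult_le_pos; [apply Hq|]. now apply Rlt_le, Rinv_0_lt_compat. }
  apply (intg_unique _ _ _ F1).
  apply (tonelli (fun t s => p t / c t * overlap phi f t s * (q s / c s))
           (fun t => p t * step phi f c q t / c t)); auto.
  - ctn; auto.
  - intros t s. apply Rmult_le_pos; [apply Rmult_le_pos|]; auto.
    exact (overlap_nonneg _ _ _ _ _ M t s).
  - intros t. replace (p t * step phi f c q t / c t) with (p t / c t * step phi f c q t)
      by (field; apply N).
    apply intg_ext with (fun s => p t / c t * (q s * (overlap phi f s t / c s))).
    + intros s. rewrite (overlap_sym _ _ s t). field. auto.
    + apply (intg_scal (p t / c t) (fun s => q s * (overlap phi f s t / c s))); auto.
      ctn; auto.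
  - ctn; auto.
  - intros s. replace (step phi f c p s * q s / c s) with (q s / c s * step phi f c p s)
      by (field; apply N).
    apply intg_ext with (fun t => q s / c s * (p t * (overlap phi f t s / c t))).
    + intros t. field. auto.
    + apply (intg_scal (q s / c s) (fun t => p t * (overlap phi f t s / c t))); auto.
      ctn; auto.
  - ctn; auto.
Qed.

Lemma marg_dominated phi f c B Z : flat_model phi f c B Z -> dominated c 1 c.
Proof.
  intros M. split; [exact (marg_cont _ _ _ _ _ M)|].
  intros t. assert (P := marg_pos _ _ _ _ _ M t). lra.
Qed.

Lemma step_marg phi f c B Z : flat_model phi f c B Z -> step phi f c c = c.
Proof.
  intros M. apply functional_extensionality. intros s.
  assert (I := step_intg _ _ _ _ _ _ _ M (marg_dominated _ _ _ _ _ M) s).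
  apply (intg_unique _ _ _ I).
  apply intg_ext with (overlap phi f s); [|exact (overlap_marginal _ _ _ _ _ M s)].
  intros t. rewrite (overlap_sym _ _ s t). field. exact (div_pos_ne c (marg_pos _ _ _ _ _ M) t).
Qed.

(** Total mass is the pairing with c, so mass conservation follows from self-adjointness and
    invariance of c. *)
Lemma mass_intg phi f c B Z U p : flat_model phi f c B Z -> dominated c U p ->
  intg p (form c p c).
Proof.
  intros M Hp. assert (F := form_intg _ _ _ _ _ _ _ _ _ M Hp (marg_dominated _ _ _ _ _ M)).
  revert F. apply intg_ext. intros t. field. exact (div_pos_ne c (marg_pos _ _ _ _ _ M) t).
Qed.

(** * Decay of the L^2 energy *)

(* Index [j] is the law of Theta_(j+1) given Theta_0 = t0. *)
Fixpoint gibbs_density (phi f c : R -> R) (t0 : R) (j : nat) : R -> R :=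
  match j with
  | O => fun s => overlap phi f t0 s / c t0
  | S i => step phi f c (gibbs_density phi f c t0 i)
  end.

Lemma gibbs_density_dominated phi f c B Z t0 j : flat_model phi f c B Z ->
  dominated c (B / c t0) (gibbs_density phi f c t0 j).
Proof.
  intros M. induction j as [|j IH]; [|exact (step_dominated _ _ _ _ _ _ _ M IH)].
  assert (J := overlap_jcont _ _ _ _ _ M). assert (P := marg_pos _ _ _ _ _ M).
  assert (C := jcont_slice _ t0 J). assert (I := Rinv_0_lt_compat _ (P t0)).
  split; simpl.
  - ctn. apply Rgt_not_eq, P.
  - intros s. split.
    + apply Rmult_le_pos; [exact (overlap_nonneg _ _ _ _ _ M t0 s)|lra].
    + replace (B / c t0 * c s) with (B * c s / c t0) by (field; apply Rgt_not_eq, P).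
      apply Rmult_le_compat_r; [lra|]. rewrite overlap_sym. exact (overlap_le _ _ _ _ _ M s t0).
Qed.

Lemma gibbs_density_mass phi f c B Z t0 j : flat_model phi f c B Z ->
  form c (gibbs_density phi f c t0 j) c = 1.
Proof.
  intros M. assert (P := marg_pos _ _ _ _ _ M).
  assert (C := jcont_slice _ t0 (overlap_jcont _ _ _ _ _ M)).
  induction j as [|j IH].
  - assert (D := gibbs_density_dominated _ _ _ _ _ t0 0 M).
    apply (intg_unique _ _ _ (mass_intg _ _ _ _ _ _ _ M D)). simpl.
    replace 1 with (/ c t0 * c t0) by (field; apply Rgt_not_eq, P).
    apply intg_ext with (fun s => / c t0 * overlap phi f t0 s); [intros; unfold Rdiv; ring|].
    apply (intg_scal (/ c t0) (overlap phi f t0)); auto.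
    + apply Rlt_le, Rinv_0_lt_compat, P.
    + exact (overlap_marginal _ _ _ _ _ M t0).
  - simpl. assert (D := gibbs_density_dominated _ _ _ _ _ t0 j M).
    rewrite (form_step _ _ _ _ _ _ _ _ _ M D (marg_dominated _ _ _ _ _ M)).
    now rewrite (step_marg _ _ _ _ _ M).
Qed.

Lemma discriminant_nonpos (X Y W : R) :
  (forall a b, 0 <= a ^ 2 * X + 2 * a * b * Y + b ^ 2 * W) -> Y ^ 2 <= X * W.
Proof.
  intros H. assert (X0 := H 1 0). ring_simplify in X0.
  destruct (Req_dec X 0) as [E|E].
  - subst X. destruct (Req_dec Y 0) as [E|E]; [subst Y; lra|].
    (* For X = 0 the form at (a, 1) is 2 a Y + W, and this a makes it -1. *)
    assert (H1 := H (- (W + 1) / (2 * Y)) 1).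
    replace (2 * (- (W + 1) / (2 * Y)) * 1 * Y) with (- (W + 1)) in H1 by (field; auto). lra.
  (* The form at (-Y, X) equals X (X W - Y^2). *)
  - assert (H1 := H (- Y) X). nra.
Qed.

(* The limit is the squared norm of a(p/c-1/Z)+b(q/c-1/Z) in L^2(c). *)
Lemma centred_square_lim phi f c B Z U V p q a b : flat_model phi f c B Z ->
  dominated c U p -> dominated c V q -> form c p c = 1 -> form c q c = 1 ->
  is_lim_seq (fun n => RInt (fun t => c t * (a * (p t / c t - / Z) + b * (q t / c t - / Z)) ^ 2)
                         (- INR n) (INR n))
    (a ^ 2 * (form c p p - / Z) + 2 * a * b * (form c p q - / Z) + b ^ 2 * (form c q q - / Z)).
Proof.
  intros M Hp Hq Mp Mq. assert (P := marg_pos _ _ _ _ _ M).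
  assert (N := div_pos_ne c P). assert (Z0 := total_pos _ _ _ _ _ M).
  assert (CC := marg_cont _ _ _ _ _ M).
  assert (Ipp := form_intg _ _ _ _ _ _ _ _ _ M Hp Hp).
  assert (Ipq := form_intg _ _ _ _ _ _ _ _ _ M Hp Hq).
  assert (Iqq := form_intg _ _ _ _ _ _ _ _ _ M Hq Hq).
  assert (Ip := mass_intg _ _ _ _ _ _ _ M Hp). rewrite Mp in Ip.
  assert (Iq := mass_intg _ _ _ _ _ _ _ M Hq). rewrite Mq in Iq.
  assert (Ic := total_intg _ _ _ _ _ M).
  destruct Hp as [Cp Hp], Hq as [Cq Hq].
  assert (Dv : forall u v t, 0 <= u -> 0 <= v -> 0 <= u * v / c t).
  { intros u v t Hu Hv. apply Rmult_le_pos; [now apply Rmult_le_pos|].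
    now apply Rlt_le, Rinv_0_lt_compat. }
  assert (Cpp : cont (fun t => p t * p t / c t)) by (ctn; auto).
  assert (Cpq : cont (fun t => p t * q t / c t)) by (ctn; auto).
  assert (Cqq : cont (fun t => q t * q t / c t)) by (ctn; auto).
  (* Expanding the square gives six integrals of nonnegative functions with signed coefficients. The
     last three have limits 1, 1 and Z, and together contribute -(a + b)^2 / Z. *)
  apply (is_lim_seq_ext
    (fun n => a ^ 2 * RInt (fun t => p t * p t / c t) (- INR n) (INR n)
      + (2 * a * b * RInt (fun t => p t * q t / c t) (- INR n) (INR n)
      + (b ^ 2 * RInt (fun t => q t * q t / c t) (- INR n) (INR n)
      + (- (2 * (a ^ 2 + a * b) / Z) * RInt p (- INR n) (INR n)
      + (- (2 * (a * b + b ^ 2) / Z) * RInt q (- INR n) (INR n)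
      + ((a + b) ^ 2 / Z ^ 2) * RInt c (- INR n) (INR n))))))).
  - intros n. rewrite <- !RInt_mul by auto.
    rewrite <- !RInt_add by (ctn; auto).
    (* The equality is restated at type R, where [field] applies. *)
    apply RInt_ext. intros t _. match goal with |- ?u = ?v => change (@eq R u v) end.
    field. split; auto; lra.
  - replace (a ^ 2 * (form c p p - / Z) + 2 * a * b * (form c p q - / Z)
             + b ^ 2 * (form c q q - / Z)) with
      (a ^ 2 * form c p p + (2 * a * b * form c p q + (b ^ 2 * form c q q
       + (- (2 * (a ^ 2 + a * b) / Z) * 1 + (- (2 * (a * b + b ^ 2) / Z) * 1
       + ((a + b) ^ 2 / Z ^ 2) * Z))))) by (field; lra).
    assert (S : forall k g l, cont g -> (forall t, 0 <= g t) -> intg g l ->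
              is_lim_seq (fun n => k * RInt g (- INR n) (INR n)) (k * l)).
    { intros k g l Hc H0 Hl. apply (is_lim_seq_scal_l _ k l). now apply intg_is_lim_seq. }
    repeat (apply is_lim_seq_plus'; [apply S; auto|]); try (apply S; auto);
      intros t; try (apply Dv; first [apply Hp|apply Hq]);
      try apply Hp; try apply Hq; apply Rlt_le, P.
Qed.

Lemma centred_square_nonneg phi f c B Z U V p q a b : flat_model phi f c B Z ->
  dominated c U p -> dominated c V q -> form c p c = 1 -> form c q c = 1 ->
  0 <= a ^ 2 * (form c p p - / Z) + 2 * a * b * (form c p q - / Z)
       + b ^ 2 * (form c q q - / Z).
Proof.
  intros M Hp Hq Mp Mq.
  assert (L := centred_square_lim _ _ _ _ _ _ _ _ _ a b M Hp Hq Mp Mq).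
  refine (is_lim_seq_le (fun _ => 0) _ 0 _ _ (is_lim_seq_const 0) L).
  intros n. apply RInt_nonneg.
  - destruct Hp as [Cp _], Hq as [Cq _]. assert (C := marg_cont _ _ _ _ _ M).
    assert (N := div_pos_ne c (marg_pos _ _ _ _ _ M)). ctn; auto.
  - intros t. apply Rmult_le_pos; [apply Rlt_le, (marg_pos _ _ _ _ _ M)|apply pow2_ge_0].
  - assert (A := pos_INR n). lra.
Qed.

Lemma centred_cauchy_schwarz phi f c B Z U V p q : flat_model phi f c B Z ->
  dominated c U p -> dominated c V q -> form c p c = 1 -> form c q c = 1 ->
  (form c p q - / Z) ^ 2 <= (form c p p - / Z) * (form c q q - / Z).
Proof.
  intros M Hp Hq Mp Mq. apply discriminant_nonpos. intros a b.
  exact (centred_square_nonneg _ _ _ _ _ _ _ _ _ a b M Hp Hq Mp Mq).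
Qed.

(** The integrand c (p/c - 1/Z)^2 is the product of p - c/Z, whose absolute integral is twice the
    total variation distance, and p/c - 1/Z, which is at most U + 1/Z in absolute value. *)
Lemma centred_square_le_tv phi f c B Z U p : flat_model phi f c B Z ->
  dominated c U p -> form c p c = 1 ->
  0 <= tv_dist p (fun t => c t / Z) /\
  form c p p - / Z <= 2 * (U + / Z) * tv_dist p (fun t => c t / Z).
Proof.
  intros M Hp Mp. assert (P := marg_pos _ _ _ _ _ M).
  assert (N := div_pos_ne c P). assert (Z0 := total_pos _ _ _ _ _ M).
  assert (C := marg_cont _ _ _ _ _ M). assert (ZI := Rinv_0_lt_compat _ Z0).
  assert (L := centred_square_lim _ _ _ _ _ _ _ _ _ 1 0 M Hp Hp Mp Mp).
  replace (1 ^ 2 * (form c p p - / Z) + 2 * 1 * 0 * (form c p p - / Z)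
           + 0 ^ 2 * (form c p p - / Z)) with (form c p p - / Z) in L by ring.
  destruct Hp as [Cp Hp].
  assert (CT : cont (fun t => Rabs (p t - c t / Z))) by (ctn; lra).
  assert (BT : forall t, Rabs (p t - c t / Z) <= (U + / Z) * c t).
  { intros t. assert (A := Hp t). assert (A' := P t).
    assert (A2 : 0 <= c t / Z) by (apply Rmult_le_pos; lra).
    unfold Rdiv in *. apply Rabs_le. nra. }
  assert (U0 : 0 <= U).
  { assert (A := Hp 0). assert (A' := P 0). nra. }
  assert (IT : intg (fun t => Rabs (p t - c t / Z)) (RInt_R (fun t => Rabs (p t - c t / Z)))).
  { apply intg_RInt_R; auto; [intros; apply Rabs_pos|].
    apply (intg_dominated _ (fun t => (U + / Z) * c t) ((U + / Z) * Z)); auto.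
    - ctn.
    - intros t. split; [apply Rabs_pos|apply BT].
    - apply intg_scal; auto; [lra|]. exact (total_intg _ _ _ _ _ M). }
  unfold tv_dist. split; [assert (K := intg_nonneg _ _ IT); lra|].
  assert (K : form c p p - / Z <= (U + / Z) * RInt_R (fun t => Rabs (p t - c t / Z))); [|lra].
  refine (is_lim_seq_le _
    (fun n => (U + / Z) * RInt (fun t => Rabs (p t - c t / Z)) (- INR n) (INR n))
    _ ((U + / Z) * RInt_R (fun t => Rabs (p t - c t / Z))) _ L _).
  - intros n. rewrite <- RInt_mul by auto. apply RInt_mono.
    + ctn; auto.
    + ctn; lra.
    + intros t _.
      assert (B1 : Rabs (p t / c t - / Z) <= U + / Z).
      { replace (p t / c t - / Z) with ((p t - c t / Z) / c t) by (field; split; auto; lra).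
        unfold Rdiv at 1. rewrite Rabs_mult, (Rabs_right (/ c t))
          by (apply Rle_ge, Rlt_le, Rinv_0_lt_compat, P).
        apply Rmult_le_reg_r with (c t); [apply P|]. rewrite Rmult_assoc, Rinv_l, Rmult_1_r; auto. }
      replace (c t * (1 * (p t / c t - / Z) + 0 * (p t / c t - / Z)) ^ 2)
        with ((p t - c t / Z) * (p t / c t - / Z)) by (field; split; auto; lra).
      eapply Rle_trans; [apply Rle_abs|]. rewrite Rabs_mult, Rmult_comm.
      apply Rmult_le_compat_r; [apply Rabs_pos|exact B1].
    + assert (A := pos_INR n). lra.
  - apply (is_lim_seq_scal_l _ (U + / Z) (RInt_R (fun t => Rabs (p t - c t / Z)))).
    apply intg_is_lim_seq; auto. intros; apply Rabs_pos.
Qed.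

(* Log-convexity removes the constant: the ratios E (S j) / E j increase to a limit <= r. *)
Lemma log_convex_geometric (E : nat -> R) (C r : R) :
  0 < r -> (forall j, 0 <= E j) -> (forall j, E (S j) ^ 2 <= E j * E (S (S j))) ->
  (forall j, E j <= C * r ^ j) -> forall j, E j <= E O * r ^ j.
Proof.
  intros Hr H0 HL HC.
  assert (W : forall j, E (S j) <= r * E j).
  { intros j. apply Rnot_lt_le. intros L.
    (* If E j were 0, log-convexity would make E (S j) vanish too, against [L]. *)
    assert (Ej : 0 < E j).
    { destruct (H0 j) as [K|K]; auto. rewrite <- K in L. assert (A := HL j).
      rewrite <- K in A. nra. }
    set (rho := E (S j) / E j).
    assert (Hrho : r < rho).
    { unfold rho. apply Rmult_lt_reg_r with (E j); auto.
      unfold Rdiv. rewrite Rmult_assoc, Rinv_l, Rmult_1_r; lra. }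
    assert (S1 : forall k, 0 < E (k + j)%nat /\ rho * E (k + j)%nat <= E (S (k + j))).
    { induction k as [|k [I1 I2]].
      - split; auto. simpl. unfold rho. right. field. lra.
      - assert (I3 : 0 < E (S k + j)%nat).
        { eapply Rlt_le_trans; [|exact I2]. apply Rmult_lt_0_compat; lra. }
        split; auto. assert (A := HL (k + j)%nat). simpl in *.
        apply Rmult_le_reg_l with (E (k + j)%nat); auto. nra. }
    assert (S2 : forall k, rho ^ k * E j <= E (k + j)%nat).
    { induction k as [|k IH]; [simpl; lra|].
      eapply Rle_trans; [|apply (proj2 (S1 k))]. simpl. rewrite Rmult_assoc.
      apply Rmult_le_compat_l; lra. }
    assert (Q : 1 < rho / r).
    { apply Rmult_lt_reg_r with r; auto. unfold Rdiv.
      rewrite Rmult_assoc, Rinv_l, Rmult_1_r; lra. }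
    (* This k makes rho^k E j, a lower bound for E (k + j), exceed C r^(k + j). *)
    destruct (Pow_x_infinity (rho / r)) with (b := C * r ^ j / E j + 1) as [k Hk].
    { rewrite Rabs_right; lra. }
    specialize (Hk k (Nat.le_refl k)). rewrite Rabs_right in Hk
      by (apply Rle_ge, pow_le; lra).
    assert (X : rho ^ k * E j <= C * r ^ (k + j)) by (eapply Rle_trans; [apply S2|apply HC]).
    rewrite pow_add in X. 
    assert (Hq : (rho / r) ^ k = rho ^ k * / r ^ k)
      by (unfold Rdiv; now rewrite Rpow_mult_distr, pow_inv).
    rewrite Hq in Hk.
    assert (rk := pow_lt r k Hr).
    assert (Y : rho ^ k * / r ^ k <= C * r ^ j / E j).
    { apply Rmult_le_reg_r with (E j); auto. apply Rmult_le_reg_l with (r ^ k); auto.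
      replace (r ^ k * (rho ^ k * / r ^ k * E j)) with (rho ^ k * E j) by (field; lra).
      replace (r ^ k * (C * r ^ j / E j * E j)) with (C * (r ^ k * r ^ j)) by (field; lra).
      exact X. }
    lra. }
  induction j as [|j IH]; [simpl; lra|].
  eapply Rle_trans; [apply W|]. simpl. nra.
Qed.

Lemma gibbs_density_energy phi f c B Z t0 r C : flat_model phi f c B Z -> 0 < r ->
  (forall j, tv_dist (gibbs_density phi f c t0 j) (fun t => c t / Z) <= C * r ^ j) ->
  forall j, form c (gibbs_density phi f c t0 j) (gibbs_density phi f c t0 j)
            <= B / c t0 * r ^ j + / Z.
Proof.
  intros M Hr HT.
  assert (P := marg_pos _ _ _ _ _ M). assert (Z0 := total_pos _ _ _ _ _ M).
  assert (ZI := Rinv_0_lt_compat _ Z0). assert (BP := noise_bound_pos _ _ _ _ _ M).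
  assert (U0 : 0 < B / c t0) by (apply Rdiv_lt_0_compat; auto).
  assert (D := fun j => gibbs_density_dominated _ _ _ _ _ t0 j M).
  assert (Ms := fun j => gibbs_density_mass _ _ _ _ _ t0 j M).
  set (p := gibbs_density phi f c t0) in *.
  set (E := fun j => form c (p j) (p j) - / Z).
  assert (G : forall j, E j <= E O * r ^ j).
  { apply log_convex_geometric with (2 * (B / c t0 + / Z) * C); auto.
    - intros j. unfold E.
      assert (L := centred_square_nonneg _ _ _ _ _ _ _ _ _ 1 0 M (D j) (D j) (Ms j) (Ms j)). lra.
    - intros j. unfold E.
      (* Moving one step across the form turns Cauchy-Schwarz for p_j and p_(j+2) into
         log-convexity. *)
      replace (form c (p (S j)) (p (S j))) with (form c (p j) (p (S (S j)))).
      + exact (centred_cauchy_schwarz _ _ _ _ _ _ _ _ _ M (D j) (D (S (S j))) (Ms j) (Ms (S (S j)))).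
      + symmetry. exact (form_step _ _ _ _ _ _ _ _ _ M (D j) (D (S j))).
    - intros j. unfold E.
      eapply Rle_trans; [apply (centred_square_le_tv _ _ _ _ _ _ _ M (D j) (Ms j))|].
      rewrite (Rmult_assoc _ C). apply Rmult_le_compat_l; [lra|apply HT]. }
  (* Pointwise p_0 / c <= B / c(t0), and p_0 has mass 1. *)
  assert (E0 : form c (p O) (p O) <= B / c t0).
  { assert (F1 := form_intg _ _ _ _ _ _ _ _ _ M (D O) (D O)).
    assert (F2 := mass_intg _ _ _ _ _ _ _ M (D O)). rewrite Ms in F2.
    destruct (D O) as [Cp Hp]. assert (C' := marg_cont _ _ _ _ _ M).
    assert (N := div_pos_ne c P).
    rewrite <- (Rmult_1_r (B / c t0)).
    refine (intg_mono _ (fun t => B / c t0 * p O t) _ _ _ _ _ F1 _).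
    - ctn; auto.
    - ctn; auto.
    - intros t. replace (p O t * p O t / c t) with (p O t / c t * p O t) by (field; auto).
      apply Rmult_le_compat_r; [apply Hp|].
      apply Rmult_le_reg_r with (c t); auto. unfold Rdiv at 1.
      rewrite Rmult_assoc, Rinv_l, Rmult_1_r; auto. apply Hp.
    - apply intg_scal; auto. lra. }
  intros j. assert (G' := G j). unfold E in G' at 1.
  assert (E O * r ^ j <= B / c t0 * r ^ j); [|lra].
  apply Rmult_le_compat_r; [now apply pow_le, Rlt_le|]. unfold E. lra.
Qed.

(** * Consequences of robustness in data *)

(** RID multiplied through by c(t), for nonnegative tests and t tending to plus infinity: J is c(t)
    times the conditional expectation of h(X - t) given Theta = t, and j the expectation of h under
    f. *)
Definition robust_in_data (phi f c : R -> R) : Prop :=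
  forall h : R -> R, cont h -> (forall u, 0 <= h u) -> (exists H, forall u, h u <= H) ->
  forall j eps, intg (fun u => h u * f u) j -> 0 < eps ->
  exists T, forall t, T < t ->
    forall J, intg (fun u => h u * (phi (u + t) * f u)) J -> Rabs (J - j * c t) <= eps * c t.

(** Far out, X - t has nearly the density f, and given X the difference between X and the next Theta
    has density f. So the displacement of Theta is nearly a difference of two independent draws from
    f, each lying in [-A, A] with probability close to 1. *)
Lemma kernel_tight phi f c B Z eps : flat_model phi f c B Z -> robust_in_data phi f c ->
  0 < eps < 1 ->
  exists A T, 1 <= A /\ forall t, T < t ->
    (1 - eps) * c t <= RInt (overlap phi f t) (t - A) (t + A).
Proof.
  intros M HR He. assert (J := overlap_jcont _ _ _ _ _ M).
  assert (O := overlap_intg _ _ _ _ _ M). assert (P := marg_pos _ _ _ _ _ M).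
  destruct M as [pc ppos0 pI fc fpos0 fB fI cI ZI].
  destruct (proj2 fI (eps / 4)) as (A0 & HA0 & HQ0); [lra|].
  (* The maximum with 1 makes the later windows have half-length at least 1, as [marg_window]
     requires. *)
  set (A := Rmax A0 1). assert (A1 := Rmax_l A0 1). assert (A2 := Rmax_r A0 1). fold A in A1, A2.
  assert (fpos : forall x, 0 <= f x) by (intros; now apply Rlt_le).
  assert (HQ : 1 - eps / 4 < RInt f (- A) A).
  { eapply Rlt_le_trans; [exact HQ0|]. apply RInt_incl; auto; lra. }
  set (q := RInt f (- A) A) in *.
  (* The conditional probability that the next Theta lies within 2A of t, given X = t + u. *)
  set (h := fun u => RInt (fun w => f (w + u)) (- (2 * A)) (2 * A)).
  assert (hE : forall u, h u = RInt f (- (2 * A) + u) (2 * A + u)).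
  { intros u. unfold h. now apply RInt_shift. }
  assert (Ch : cont h).
  { apply (cont_RInt_param_gen (fun u w => f (w + u))). ctn. }
  assert (h0 : forall u, 0 <= h u).
  { intros u. rewrite hE. apply RInt_nonneg; auto; lra. }
  assert (h1 : forall u, h u <= 1).
  { intros u. rewrite hE. apply (proj1 fI). lra. }
  assert (Chf : cont (fun u => h u * f u)) by ctn.
  destruct (intg_dominated (fun u => h u * f u) f 1) as [j Hj]; auto.
  { intros u. assert (X := h0 u). assert (Y := h1 u). assert (W := fpos u). nra. }
  (* For |u| <= A the interval [u - 2A, u + 2A] contains [-A, A], so h(u) >= q there. *)
  assert (Hj2 : q * q <= j).
  { eapply Rle_trans; [|apply (proj1 Hj (- A) A); lra].
    assert (W : RInt (fun u => q * f u) (- A) A = q * q) by (now rewrite RInt_mul).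
    rewrite <- W. apply RInt_mono; auto; [ctn| |lra].
    intros u Hu. apply Rmult_le_compat_r; auto. rewrite hE. apply RInt_incl; auto; lra. }
  destruct (HR h Ch h0 ltac:(exists 1; exact h1) j (eps / 4) Hj) as [T HT]; [lra|].
  exists (2 * A), T. split; [lra|]. intros t Ht.
  assert (GJ : jcont (fun s x => phi x * f (x - t) * f (x - s))) by ctn.
  assert (GP : forall s x, 0 <= phi x * f (x - t) * f (x - s)).
  { intros s x. apply Rmult_le_pos; auto. apply Rmult_le_pos; auto. now apply Rlt_le. }
  assert (Ct : cont (overlap phi f t)) by now apply jcont_slice.
  assert (S : intg (fun x => RInt (fun s => phi x * f (x - t) * f (x - s)) (t - 2 * A) (t + 2 * A))
                (RInt (overlap phi f t) (t - 2 * A) (t + 2 * A))).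
  { apply (tonelli_strip (fun s x => phi x * f (x - t) * f (x - s)) (overlap phi f t)); auto. lra. }
  assert (Hw : t - 2 * A <= t + 2 * A) by lra.
  assert (CS : cont (fun x => RInt (fun s => phi x * f (x - t) * f (x - s)) (t - 2 * A) (t + 2 * A))).
  { apply (cont_RInt_param_gen (fun x s => phi x * f (x - t) * f (x - s))).
    exact (jcont_swap _ GJ). }
  apply (intg_shift t) in S; [|exact CS|].
  2: { intros x. apply RInt_nonneg; auto. exact (jcont_slice _ x (jcont_swap _ GJ)). }
  apply (intg_ext _ (fun u => h u * (phi (u + t) * f u))) in S.
  - specialize (HT t Ht _ S). apply Rabs_le_between in HT. assert (Pt := P t).
    assert (1 - eps / 2 <= q * q) by nra.
    assert ((1 - eps / 2) * c t <= j * c t) by (apply Rmult_le_compat_r; lra). nra.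
  - intros u.
    assert (Cu : cont (fun s => f (u + t - s))) by ctn.
    rewrite (RInt_mul (phi (u + t) * f (u + t - t)) (fun s => f (u + t - s))) by exact Cu.
    rewrite (RInt_reflect_shift f) by auto. rewrite hE.
    replace (u + t - (t + 2 * A)) with (- (2 * A) + u) by ring.
    replace (u + t - (t - 2 * A)) with (2 * A + u) by ring.
    replace (u + t - t) with u by ring. ring.
Qed.

(** The trapezoid equal to 1 on [-L, L], to 0 where |x| >= L + 1, and linear in between. Absolute
    values in place of cases make continuity automatic. *)
Definition tent (L x : R) : R := (Rabs (L + 1 - Rabs x) - Rabs (L - Rabs x) + 1) * / 2.

Lemma tent_cont L : cont (tent L).
Proof. unfold tent. ctn. Qed.

Lemma tent_range L x : 0 <= tent L x <= 1.
Proof. unfold tent. unfold Rabs. repeat destruct Rcase_abs; lra. Qed.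

Lemma tent_out L x : L + 1 <= Rabs x -> tent L x = 0.
Proof.
  unfold tent. intros H. rewrite (Rabs_left1 (L + 1 - Rabs x)), (Rabs_left1 (L - Rabs x)); lra.
Qed.

Lemma tent_pos L x : Rabs x < L + 1 -> 0 < tent L x.
Proof.
  unfold tent. intros H. rewrite (Rabs_right (L + 1 - Rabs x)) by lra.
  destruct (Rlt_le_dec (L - Rabs x) 0).
  - rewrite (Rabs_left (L - Rabs x)); lra.
  - rewrite (Rabs_right (L - Rabs x)); lra.
Qed.

Lemma tent_in L x : Rabs x <= L -> tent L x = 1.
Proof. unfold tent. intros H. rewrite (Rabs_right (L + 1 - Rabs x)), (Rabs_right (L - Rabs x)); lra. Qed.

(** By robustness, a share of c(t) of at least j/2 > 0 comes from x within distance 1 of t, and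
    there f <= B. *)
Lemma marg_le_local phi f c B Z : flat_model phi f c B Z -> robust_in_data phi f c ->
  exists C T, 0 < C /\ forall t, T < t -> c t <= C * RInt phi (t - 1) (t + 1).
Proof.
  intros M HR. assert (P := marg_pos _ _ _ _ _ M). assert (BP := noise_bound_pos _ _ _ _ _ M).
  destruct M as [pc ppos0 pI fc fpos0 fB fI cI ZI].
  assert (fpos : forall x, 0 <= f x) by (intros; now apply Rlt_le).
  assert (ppos : forall x, 0 <= phi x) by (intros; now apply Rlt_le).
  assert (Ct := tent_cont 0). assert (Rt := tent_range 0).
  assert (Chf : cont (fun u => tent 0 u * f u)) by ctn.
  destruct (intg_dominated (fun u => tent 0 u * f u) f 1) as [j Hj]; auto.
  { intros u. assert (X := Rt u). assert (W := fpos u). nra. }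
  assert (J0 : 0 < j).
  { apply Rlt_le_trans with (RInt (fun u => tent 0 u * f u) (-1) 1).
    - apply RInt_gt_0; [lra| |intros; apply Chf].
      intros u Hu. apply Rmult_lt_0_compat; auto. apply tent_pos. apply Rabs_def1; lra.
    - apply (proj1 Hj). lra. }
  destruct (HR (tent 0) Ct (fun u => proj1 (Rt u)) ltac:(exists 1; intros u; apply Rt)
              j (j / 2) Hj) as [T HT]; [lra|].
  exists (2 * B / j), T. split; [apply Rdiv_lt_0_compat; lra|]. intros t Ht.
  assert (CG : cont (fun u => tent 0 u * (phi (u + t) * f u))) by ctn.
  assert (CD : cont (fun u => B * phi (u + t))) by ctn.
  assert (G1 : forall u, 0 <= tent 0 u * (phi (u + t) * f u) <= B * phi (u + t)).
  { intros u. assert (X := Rt u). assert (X1 := fpos u). assert (X2 := fB u).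
    assert (X3 := ppos (u + t)).
    assert (X4 : 0 <= phi (u + t) * f u) by now apply Rmult_le_pos. split; [nra|].
    apply Rle_trans with (1 * (phi (u + t) * f u)); [apply Rmult_le_compat_r; lra|]. nra. }
  destruct (intg_dominated _ _ (B * 1) CG CD G1) as [K HK].
  { apply (intg_scal B (fun u => phi (u + t))); [ctn|lra|]. now apply intg_shift. }
  specialize (HT t Ht K HK). apply Rabs_le_between in HT.
  assert (KE : K <= B * RInt phi (t - 1) (t + 1)).
  { rewrite (intg_unique _ K (RInt (fun u => tent 0 u * (phi (u + t) * f u)) (-1) 1) HK).
    - replace (t - 1) with (-1 + t) by ring. replace (t + 1) with (1 + t) by ring.
      rewrite <- (RInt_shift phi t) by auto.
      rewrite <- (RInt_mul B (fun u => phi (u + t))) by ctn.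
      apply RInt_mono; auto; [|lra]. intros u _. apply G1.
    - apply intg_supported; auto; [apply G1|lra|].
      intros u Hu. rewrite tent_out; [ring|]. unfold Rabs; destruct Rcase_abs; lra. }
  apply Rmult_le_reg_l with (j / 2); [lra|].
  replace (j / 2 * (2 * B / j * RInt phi (t - 1) (t + 1)))
    with (B * RInt phi (t - 1) (t + 1)) by (field; lra). lra.
Qed.

(* Testing against tent/f bounds the mass of phi without a constant depending on f. *)
Lemma window_le_marg phi f c B Z L : flat_model phi f c B Z -> robust_in_data phi f c ->
  0 <= L -> exists T, forall t, T < t -> RInt phi (t - L) (t + L) <= (2 * L + 3) * c t.
Proof.
  intros M HR HL. assert (P := marg_pos _ _ _ _ _ M). destruct M as [pc ppos0 pI fc fpos0 fB fI cI ZI].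
  assert (fpos : forall x, 0 <= f x) by (intros; now apply Rlt_le).
  assert (fne : forall x, f x <> 0) by (intros; apply Rgt_not_eq, fpos0).
  assert (ppos : forall x, 0 <= phi x) by (intros; now apply Rlt_le).
  assert (Ct := tent_cont L). assert (Rt := tent_range L).
  assert (Ch : cont (fun u => tent L u / f u)) by (ctn; auto).
  assert (h0 : forall u, 0 <= tent L u / f u).
  { intros u. apply Rmult_le_pos; [apply Rt|]. now apply Rlt_le, Rinv_0_lt_compat. }
  (* The minimum serves to make the test function bounded; it may influence T, but not the
     estimate. *)
  destruct (continuity_ab_min f (- (L + 1)) (L + 1)) as [m [Hm _]]; [lra| |].
  { intros x _. apply continuity_pt_filterlim. apply fc. }
  assert (h1 : forall u, tent L u / f u <= / f m).
  { intros u. assert (I := Rinv_0_lt_compat _ (fpos0 m)).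
    destruct (Rle_dec (L + 1) (Rabs u)) as [K|K].
    - rewrite tent_out by exact K. unfold Rdiv. rewrite Rmult_0_l. lra.
    - assert (K' : Rabs u < L + 1) by lra. apply Rabs_def2 in K'.
      assert (N := Rinv_le_contravar _ _ (fpos0 m) (Hm u ltac:(lra))).
      assert (N2 := Rinv_0_lt_compat _ (fpos0 u)).
      unfold Rdiv. assert (X := Rt u). nra. }
  assert (Supp : forall u, u <= - (L + 1) \/ L + 1 <= u -> tent L u = 0).
  { intros u Hu. apply tent_out. unfold Rabs; destruct Rcase_abs; lra. }
  assert (Hj : intg (tent L) (RInt (tent L) (- (L + 1)) (L + 1))).
  { apply intg_supported; auto; [apply Rt|lra]. }
  set (j := RInt (tent L) (- (L + 1)) (L + 1)) in *.
  assert (j1 : j <= 2 * L + 2).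
  { replace (2 * L + 2) with (RInt (fun _ => 1) (- (L + 1)) (L + 1))
      by (rewrite RInt_constant, Rmult_1_r; lra).
    apply RInt_mono; auto; [ctn| |lra]. intros u _. apply Rt. }
  assert (Hj' : intg (fun u => tent L u / f u * f u) j).
  { revert Hj. apply intg_ext. intros u. field. auto. }
  (* Tolerance 1 on top of j <= 2L + 2 gives the constant 2L + 3. *)
  destruct (HR _ Ch h0 ltac:(exists (/ f m); exact h1) j 1 Hj' Rlt_0_1) as [T HT].
  exists T. intros t Ht.
  assert (CG : cont (fun u => tent L u * phi (u + t))) by ctn.
  assert (CD : cont (fun u => phi (u + t))) by ctn.
  assert (G1 : forall u, 0 <= tent L u * phi (u + t) <= phi (u + t)).
  { intros u. assert (X := Rt u). assert (X3 := ppos (u + t)). nra. }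
  destruct (intg_dominated _ _ 1 CG CD G1) as [K HK]; [now apply intg_shift|].
  assert (KE : RInt phi (t - L) (t + L) <= K).
  { eapply Rle_trans; [|apply (proj1 HK (- L) L); lra].
    replace (t - L) with (- L + t) by ring. replace (t + L) with (L + t) by ring.
    rewrite <- (RInt_shift phi t) by auto.
    apply RInt_mono; auto; [|lra]. intros u Hu. rewrite tent_in; [lra|].
    apply Rabs_le. lra. }
  assert (HK' : intg (fun u => tent L u / f u * (phi (u + t) * f u)) K).
  { revert HK. apply intg_ext. intros u. field. auto. }
  specialize (HT t Ht K HK'). apply Rabs_le_between in HT. assert (Pt := P t).
  assert (j * c t <= (2 * L + 2) * c t) by (apply Rmult_le_compat_r; lra). lra.
Qed.

(** One factor L is the length of the window. The other comes from bounding each c(s) in it by the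
    mass of phi on the window enlarged by 1, which is at most (2L + 5) c(t). *)
Lemma marg_window phi f c B Z : flat_model phi f c B Z -> robust_in_data phi f c ->
  exists C, 0 < C /\ forall L, 1 <= L -> exists T, forall t, T < t ->
    RInt c (t - L) (t + L) <= C * L ^ 2 * c t.
Proof.
  intros M HR. assert (P := marg_pos _ _ _ _ _ M). assert (Cc := marg_cont _ _ _ _ _ M).
  destruct (marg_le_local _ _ _ _ _ M HR) as (C & T1 & HC & H1).
  (* For L >= 1, 2L (2L + 5) <= 14 L^2. *)
  exists (14 * C). split; [lra|]. intros L HL.
  destruct (window_le_marg _ _ _ _ _ (L + 1) M HR ltac:(lra)) as [T2 H2].
  exists (Rmax (T1 + L) T2). intros t Ht.
  assert (X1 := Rmax_l (T1 + L) T2). assert (X2 := Rmax_r (T1 + L) T2).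
  specialize (H2 t ltac:(lra)). set (W := RInt phi (t - (L + 1)) (t + (L + 1))) in *.
  assert (CP := phi_cont _ _ _ _ _ M). assert (PP := phi_pos _ _ _ _ _ M).
  assert (K : RInt c (t - L) (t + L) <= RInt (fun _ => C * W) (t - L) (t + L)).
  { apply RInt_mono; auto; [ctn| |lra]. intros s Hs.
    eapply Rle_trans; [apply H1; lra|]. apply Rmult_le_compat_l; [lra|].
    apply RInt_incl; auto; try lra. intros; now apply Rlt_le. }
  rewrite RInt_constant in K. assert (Pt := P t).
  assert (C * W <= C * ((2 * (L + 1) + 3) * c t)) by (apply Rmult_le_compat_l; lra).
  assert ((t + L - (t - L)) * (C * W) <= 2 * L * (C * ((2 * (L + 1) + 3) * c t))).
  { replace (t + L - (t - L)) with (2 * L) by ring. apply Rmult_le_compat_l; lra. }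
  assert (2 * L * (C * ((2 * (L + 1) + 3) * c t)) <= 14 * C * L ^ 2 * c t).
  { assert (0 < C * c t) by now apply Rmult_lt_0_compat.
    replace (2 * L * (C * ((2 * (L + 1) + 3) * c t))) with ((2 * L * (2 * L + 5)) * (C * c t)) by ring.
    replace (14 * C * L ^ 2 * c t) with ((14 * L ^ 2) * (C * c t)) by ring.
    apply Rmult_le_compat_r; [lra|]. nra. }
  lra.
Qed.

(** Each step costs a factor 1 - eps and widens the window by A. Starting beyond T by the full
    half-length keeps every window in the region where the kernel is tight. The exponent is S j
    because index j already stands for j + 1 steps. *)
Lemma gibbs_density_stays phi f c B Z eps A T t0 j : flat_model phi f c B Z ->
  eps < 1 -> 0 <= A ->
  (forall t, T < t -> (1 - eps) * c t <= RInt (overlap phi f t) (t - A) (t + A)) ->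
  T + INR (S j) * A < t0 ->
  (1 - eps) ^ S j <=
    RInt (gibbs_density phi f c t0 j) (t0 - INR (S j) * A) (t0 + INR (S j) * A).
Proof.
  intros M He HA HT. assert (P := marg_pos _ _ _ _ _ M). assert (N := div_pos_ne c P).
  assert (J := overlap_jcont _ _ _ _ _ M). assert (O := overlap_nonneg _ _ _ _ _ M).
  assert (Cc := marg_cont _ _ _ _ _ M).
  induction j as [|j IH]; intros Ht.
  - simpl INR in *. rewrite !Rmult_1_l in *. rewrite pow_1. simpl.
    assert (C := jcont_slice _ t0 J).
    rewrite (RInt_ext _ (fun s => / c t0 * overlap phi f t0 s))
      by (intros; unfold Rdiv; apply Rmult_comm).
    rewrite RInt_mul by auto. specialize (HT t0 ltac:(lra)).
    apply Rmult_le_reg_l with (c t0); auto.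
    rewrite <- Rmult_assoc, Rinv_r, Rmult_1_l; auto. lra.
  - rewrite (S_INR (S j)) in *. set (n := INR (S j)) in *.
    assert (n0 : 0 <= n) by apply pos_INR.
    specialize (IH ltac:(lra)).
    assert (D := gibbs_density_dominated _ _ _ _ _ t0 j M).
    assert (D' := gibbs_density_dominated _ _ _ _ _ t0 (S j) M).
    assert (I := step_intg _ _ _ _ _ _ _ M D). simpl.
    change (step phi f c (gibbs_density phi f c t0 j)) with (gibbs_density phi f c t0 (S j)) in *.
    set (p := gibbs_density phi f c t0 j) in *. destruct D as [Cp Hp].
    set (a := t0 - n * A) in *. set (b := t0 + n * A) in *.
    replace (t0 - (n + 1) * A) with (a - A) by (unfold a; ring).
    replace (t0 + (n + 1) * A) with (b + A) by (unfold b; ring).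
    assert (nA : 0 <= n * A) by now apply Rmult_le_pos.
    assert (Hab : a <= b) by (unfold a, b; lra).
    assert (GJ : jcont (fun s t => p t * (overlap phi f t s / c t))) by (ctn; auto).
    apply Rle_trans with
      (RInt (fun s => RInt (fun t => p t * (overlap phi f t s / c t)) a b) (a - A) (b + A)).
    + rewrite (fubini_rectangle (fun s t => p t * (overlap phi f t s / c t))) by auto.
      apply Rle_trans with (RInt (fun t => (1 - eps) * p t) a b).
      * rewrite RInt_mul by auto. apply Rmult_le_compat_l; [lra|exact IH].
      * apply RInt_mono; auto.
        -- ctn.
        -- apply (cont_RInt_param_gen (fun t s => p t * (overlap phi f t s / c t))).
           now apply (jcont_swap (fun s t => p t * (overlap phi f t s / c t))).
        -- intros t Hta. assert (Ct := jcont_slice _ t J).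
           rewrite (RInt_ext _ (fun s => (p t / c t) * overlap phi f t s))
             by (intros; match goal with |- ?u = ?v => change (@eq R u v) end; field; auto).
           rewrite RInt_mul by auto.
           replace ((1 - eps) * p t) with (p t / c t * ((1 - eps) * c t)) by (field; auto).
           apply Rmult_le_compat_l.
           { apply Rmult_le_pos; [apply Hp|]. now apply Rlt_le, Rinv_0_lt_compat. }
           eapply Rle_trans; [apply HT; unfold a in Hta; lra|].
           apply RInt_incl; auto; lra.
    + apply RInt_mono; auto; [|apply D'| |lra].
      * now apply (cont_RInt_param_gen (fun s t => p t * (overlap phi f t s / c t))).
      * intros s _. now apply (proj1 (I s)).
Qed.

Lemma mass_window_sq_le phi f c B Z U p a b : flat_model phi f c B Z ->
  dominated c U p -> a < b -> RInt p a b ^ 2 <= form c p p * RInt c a b.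
Proof.
  intros M Hp Hab. assert (P := marg_pos _ _ _ _ _ M). assert (N := div_pos_ne c P).
  assert (Cc := marg_cont _ _ _ _ _ M).
  assert (F := form_intg _ _ _ _ _ _ _ _ _ M Hp Hp). destruct Hp as [Cp Hp].
  set (I := RInt p a b). set (K := RInt c a b).
  assert (K0 : 0 < K) by (apply RInt_gt_0; auto).
  assert (F' := proj1 F a b (Rlt_le _ _ Hab)).
  assert (Q : cont (fun t => p t * p t / c t)) by (ctn; auto).
  (* Cauchy-Schwarz through the residual of the projection of p onto c over the window; I / K is the
     projection coefficient. *)
  assert (S : 0 <= RInt (fun t => (p t - I / K * c t) ^ 2 / c t) a b).
  { apply RInt_nonneg; [ctn; auto| |lra]. intros t.
    apply Rmult_le_pos; [apply pow2_ge_0|]. now apply Rlt_le, Rinv_0_lt_compat. }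
  rewrite (RInt_ext _ (fun t => p t * p t / c t + (- (2 * (I / K)) * p t + (I / K) ^ 2 * c t))) in S
    by (intros; match goal with |- ?u = ?v => change (@eq R u v) end; field; split; auto; lra).
  rewrite !RInt_add, !RInt_mul in S by (ctn; auto). fold I K in S.
  replace (- (2 * (I / K)) * I + (I / K) ^ 2 * K) with (- (I ^ 2 / K)) in S by (field; lra).
  apply Rmult_le_reg_r with (/ K); [now apply Rinv_0_lt_compat|].
  rewrite (Rmult_assoc _ K), Rinv_r by lra. unfold Rdiv in *. lra.
Qed.

(** Otherwise c >= d beyond T, and an interval of length Z/d + 1 there would carry mass Z + d. *)
Lemma marg_small_far phi f c B Z d T : flat_model phi f c B Z -> 0 < d ->
  exists t, T < t /\ c t < d.
Proof.
  intros M Hd. apply NNPP. intros H. assert (Cc := marg_cont _ _ _ _ _ M).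
  assert (Z0 := total_pos _ _ _ _ _ M).
  assert (K : forall t, T < t -> d <= c t).
  { intros t Ht. apply Rnot_lt_le. intros L. apply H. now exists t. }
  assert (Zd : 0 < Z / d) by now apply Rdiv_lt_0_compat.
  assert (X : RInt (fun _ => d) (T + 1) (T + 1 + (Z / d + 1)) <= RInt c (T + 1) (T + 1 + (Z / d + 1))).
  { apply RInt_mono; auto; [ctn| |lra]. intros t Ht. apply K. lra. }
  rewrite RInt_constant in X.
  assert (Y := proj1 (total_intg _ _ _ _ _ M) (T + 1) (T + 1 + (Z / d + 1)) ltac:(lra)).
  replace ((T + 1 + (Z / d + 1) - (T + 1)) * d) with (Z + d) in X by (field; lra). lra.
Qed.

(** With x = r/s <= w^3 and w < 1, two powers w^j absorb the two factors of S j, and the third tends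
    to 0. *)
Lemma geometric_beats_square (D r s : R) : 0 < r < s ->
  exists j, D * INR (S j) ^ 2 * r ^ j < s ^ S j.
Proof.
  intros H. set (x := r / s).
  assert (Hx : 0 < x < 1).
  { unfold x. split; [apply Rdiv_lt_0_compat; lra|].
    apply Rmult_lt_reg_r with s; [lra|]. unfold Rdiv. rewrite Rmult_assoc, Rinv_l; lra. }
  (* Chosen so that Bernoulli's bound w^3 >= 1 - 3 (1 - w) reads w^3 >= x. *)
  set (w := 1 - (1 - x) / 3). assert (Hw : 0 < w < 1) by (unfold w; lra).
  assert (Hw3 : x <= w * (w * w)).
  { assert (0 <= (1 - w) ^ 2 * (3 - (1 - w))) by (apply Rmult_le_pos; [apply pow2_ge_0|lra]).
    replace x with (1 - 3 * (1 - w)) by (unfold w; field).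
    replace (w * (w * w)) with (1 - 3 * (1 - w) + (1 - w) ^ 2 * (3 - (1 - w))) by ring. lra. }
  set (a := / w - 1).
  assert (Ha : 0 < a).
  { unfold a. assert (I := Rinv_lt_contravar w 1). rewrite Rinv_1 in I.
    assert (1 < / w) by (apply I; lra). lra. }
  (* Then j + 1 <= K (1 + j a) <= K (1 + a)^j, again by Bernoulli. *)
  set (K := 1 + / a). assert (Ia := Rinv_0_lt_compat _ Ha).
  assert (B : forall j, INR (S j) * w ^ j <= K).
  { intros j. assert (Q := poly j a Ha). replace (1 + a) with (/ w) in Q by (unfold a; ring).
    rewrite pow_inv in Q. assert (W := pow_lt w j ltac:(lra)).
    assert (n0 := pos_INR j). rewrite S_INR.
    assert (INR j + 1 <= K * / w ^ j).
    { apply Rle_trans with (K * (1 + INR j * a)).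
      - unfold K. replace ((1 + / a) * (1 + INR j * a)) with (1 + INR j + (INR j * a + / a))
          by (field; lra).
        assert (0 <= INR j * a) by (apply Rmult_le_pos; lra). lra.
      - apply Rmult_le_compat_l; [unfold K; lra|exact Q]. }
    apply Rmult_le_reg_r with (/ w ^ j); [now apply Rinv_0_lt_compat|].
    rewrite Rmult_assoc, Rinv_r by lra. lra. }
  assert (Dp : 0 < Rabs D + 1) by (assert (X := Rabs_pos D); lra).
  assert (Kp : 0 < K) by (unfold K; lra).
  destruct (pow_lt_1_zero w ltac:(rewrite Rabs_right; lra) (s / ((Rabs D + 1) * K ^ 2)))
    as [j Hj].
  { apply Rdiv_lt_0_compat; [lra|]. apply Rmult_lt_0_compat; auto. now apply pow_lt. }
  specialize (Hj j (Nat.le_refl j)). assert (W := pow_lt w j ltac:(lra)).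
  rewrite Rabs_right in Hj by lra. exists j.
  assert (E : r ^ j = x ^ j * s ^ j).
  { rewrite <- Rpow_mult_distr. f_equal. unfold x. field. lra. }
  rewrite E. simpl pow at 4. assert (Sj := pow_lt s j ltac:(lra)).
  rewrite <- !Rmult_assoc. apply Rmult_lt_compat_r; auto.
  assert (X1 : x ^ j <= w ^ j * (w ^ j * w ^ j)).
  { rewrite <- !Rpow_mult_distr. apply pow_incr. lra. }
  assert (n0 := pos_INR (S j)). assert (B' := B j). set (n := INR (S j)) in *.
  assert (x0 := pow_lt x j ltac:(lra)).
  apply Rle_lt_trans with ((Rabs D + 1) * K ^ 2 * w ^ j).
  - apply Rle_trans with ((Rabs D + 1) * n ^ 2 * x ^ j).
    + apply Rmult_le_compat_r; [lra|]. apply Rmult_le_compat_r; [apply pow2_ge_0|].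
      assert (X := Rle_abs D). lra.
    + rewrite !Rmult_assoc. apply Rmult_le_compat_l; [lra|].
      apply Rle_trans with (n ^ 2 * (w ^ j * (w ^ j * w ^ j))).
      * apply Rmult_le_compat_l; [apply pow2_ge_0|exact X1].
      * replace (n ^ 2 * (w ^ j * (w ^ j * w ^ j))) with ((n * w ^ j) ^ 2 * w ^ j) by ring.
        apply Rmult_le_compat_r; [lra|]. apply pow_incr. split; [|exact B'].
        apply Rmult_le_pos; lra.
  - apply Rmult_lt_compat_l with (r := (Rabs D + 1) * K ^ 2) in Hj.
    + replace ((Rabs D + 1) * K ^ 2 * (s / ((Rabs D + 1) * K ^ 2))) with s in Hj by (field; lra).
      exact Hj.
    + apply Rmult_lt_0_compat; auto. now apply pow_lt.
Qed.

Lemma no_geometric_rate phi f c B Z r (C : R -> R) : flat_model phi f c B Z ->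
  robust_in_data phi f c -> 0 < r < 1 ->
  ~ (forall t0 j, tv_dist (gibbs_density phi f c t0 j) (fun t => c t / Z) <= C t0 * r ^ j).
Proof.
  (* Here r < s < 1 and (1 - eps)^2 = s + eps^2, so the retained mass squared decays no faster than
     s^(j+1). *)
  intros M HR Hr HT. set (s := (1 + r) / 2). set (eps := (1 - s) / 2).
  assert (He : 0 < eps < 1) by (unfold eps, s; lra).
  assert (Hs : s <= (1 - eps) ^ 2).
  { replace ((1 - eps) ^ 2) with (s + eps ^ 2) by (unfold eps; field).
    assert (X := pow2_ge_0 eps). lra. }
  assert (P := marg_pos _ _ _ _ _ M). assert (Z0 := total_pos _ _ _ _ _ M).
  assert (BP := noise_bound_pos _ _ _ _ _ M).
  destruct (kernel_tight _ _ _ _ _ eps M HR He) as (A & T1 & HA & H1).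
  destruct (marg_window _ _ _ _ _ M HR) as (K & HK & H2).
  (* K A^2 (S j)^2 is K L^2, and the 2B accounts for two terms, each at most B r^j: the energy
     excess and c(t0)/Z. *)
  destruct (geometric_beats_square (K * A ^ 2 * (2 * B)) r s) as [j Hj]; [unfold s; lra|].
  set (L := INR (S j) * A).
  assert (n1 : 1 <= INR (S j)) by (rewrite S_INR; assert (X := pos_INR j); lra).
  assert (HL : 1 <= L) by (unfold L; nra).
  destruct (H2 L HL) as [T2 H2'].
  assert (rj := pow_lt r j ltac:(lra)).
  (* With j fixed, t0 is taken so far out that c(t0)/Z < B r^j. *)
  destruct (marg_small_far _ _ _ _ _ (Z * B * r ^ j) (Rmax (T1 + L) T2) M) as (t0 & Ht0 & Hc).
  { apply Rmult_lt_0_compat; auto. now apply Rmult_lt_0_compat. }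
  assert (X1 := Rmax_l (T1 + L) T2). assert (X2 := Rmax_r (T1 + L) T2).
  assert (G1 := gibbs_density_stays _ _ _ _ _ eps A T1 t0 j M ltac:(lra) ltac:(lra) H1).
  fold L in G1. specialize (G1 ltac:(lra)).
  assert (D := gibbs_density_dominated _ _ _ _ _ t0 j M).
  assert (G2 := mass_window_sq_le _ _ _ _ _ _ _ (t0 - L) (t0 + L) M D ltac:(lra)).
  assert (G3 := gibbs_density_energy _ _ _ _ _ t0 r (C t0) M ltac:(lra) (HT t0) j).
  specialize (H2' t0 ltac:(lra)). assert (Pt := P t0).
  set (I := RInt (gibbs_density phi f c t0 j) (t0 - L) (t0 + L)) in *.
  set (F := form c (gibbs_density phi f c t0 j) (gibbs_density phi f c t0 j)) in *.
  assert (S1 : s ^ S j <= I ^ 2).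
  { apply Rle_trans with (((1 - eps) ^ 2) ^ S j).
    - apply pow_incr. split; [unfold s; lra|exact Hs].
    - rewrite <- pow_mult, Nat.mul_comm, pow_mult. apply pow_incr. split; [|exact G1].
      apply pow_le. lra. }
  assert (KL : 0 < K * L ^ 2) by (apply Rmult_lt_0_compat; auto; apply pow_lt; lra).
  assert (U0 : 0 <= B / c t0 * r ^ j + / Z).
  { assert (Y1 := Rinv_0_lt_compat _ Z0). assert (Y2 := Rinv_0_lt_compat _ Pt).
    assert (0 <= B / c t0 * r ^ j); [|lra]. unfold Rdiv.
    apply Rmult_le_pos; [apply Rmult_le_pos; lra|lra]. }
  assert (W0 : 0 <= RInt c (t0 - L) (t0 + L)).
  { apply RInt_nonneg; [exact (marg_cont _ _ _ _ _ M)|intros; now apply Rlt_le|lra]. }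
  assert (S2 : I ^ 2 <= (B / c t0 * r ^ j + / Z) * (K * L ^ 2 * c t0)).
  { eapply Rle_trans; [exact G2|].
    apply Rle_trans with ((B / c t0 * r ^ j + / Z) * RInt c (t0 - L) (t0 + L)).
    - now apply Rmult_le_compat_r.
    - now apply Rmult_le_compat_l. }
  replace ((B / c t0 * r ^ j + / Z) * (K * L ^ 2 * c t0))
    with (K * L ^ 2 * (B * r ^ j + c t0 / Z)) in S2 by (field; lra).
  assert (S3 : c t0 / Z <= B * r ^ j).
  { apply Rmult_le_reg_r with Z; auto. unfold Rdiv. rewrite Rmult_assoc, Rinv_l; lra. }
  assert (S4 : K * L ^ 2 * (B * r ^ j + c t0 / Z) <= K * L ^ 2 * (2 * B * r ^ j))
    by (apply Rmult_le_compat_l; lra).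
  replace (K * A ^ 2 * (2 * B) * INR (S j) ^ 2 * r ^ j) with (K * L ^ 2 * (2 * B * r ^ j)) in Hj
    by (unfold L; ring).
  lra.
Qed.

(** * Back to the Gibbs samplers *)

Lemma continuity_cont (f : R -> R) : continuity f <-> cont f.
Proof. split; intros H x; apply continuity_pt_filterlim; apply H. Qed.

Lemma good_density_intg f : good_density f -> cont f /\ intg f 1.
Proof.
  intros (Hc & _ & Hp & _ & Hi). apply continuity_cont in Hc. split; auto.
  apply is_RInt_R_intg; auto. intros; now apply Rlt_le.
Qed.

Lemma flat_model_of_densities (f1 f2 : R -> R) (y : R) :
  good_density f1 -> good_density f2 -> posterior_proper f1 f2 y ->
  exists B Z, flat_model (fun x => f1 (y - x)) f2 (cX f1 f2 y) B Z.
Proof.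
  intros H1 H2 (Z & _ & HZ).
  destruct (good_density_intg f1 H1) as [C1 I1]. destruct (good_density_intg f2 H2) as [C2 I2].
  destruct H1 as (_ & _ & P1 & _ & _). destruct H2 as (_ & [B HB] & P2 & _ & _).
  assert (BB : forall x, f2 x <= B) by (intros x; eapply Rle_trans; [apply Rle_abs|apply HB]).
  assert (Cp : cont (fun x => f1 (y - x))) by ctn.
  assert (Ip : intg (fun x => f1 (y - x)) 1).
  { apply intg_reflect; auto. intros; now apply Rlt_le. }
  assert (Hc : forall t, intg (fun x => f1 (y - x) * f2 (x - t)) (cX f1 f2 y t)).
  { intros t. assert (P : forall x, 0 <= f1 (y - x) * f2 (x - t)).
    { intros x. apply Rmult_le_pos; now apply Rlt_le. }
    apply intg_RInt_R; auto; [ctn|].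
    apply (intg_dominated _ (fun x => B * f1 (y - x)) (B * 1)).
    - ctn.
    - ctn.
    - intros x. split; auto. rewrite Rmult_comm. apply Rmult_le_compat_r; auto.
      now apply Rlt_le.
    - apply (intg_scal B (fun x => f1 (y - x))); auto.
      assert (X := P2 0). assert (Y := BB 0). lra. }
  assert (Cc : cont (cX f1 f2 y)).
  { apply (correlation_cont (fun x => f1 (y - x)) f2 _ B); auto. }
  exists B, Z. constructor; auto. apply is_RInt_R_intg; auto.
  intros t. exact (intg_nonneg _ _ (Hc t)).
Qed.

Lemma gibbs_kernel_overlap (f1 f2 : R -> R) (y B Z t s : R) :
  good_density f1 -> good_density f2 ->
  flat_model (fun x => f1 (y - x)) f2 (cX f1 f2 y) B Z ->
  gibbs_kernel (condX f1 f2 y) (condTheta_X f1 f2 y) t s =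
  overlap (fun x => f1 (y - x)) f2 t s / cX f1 f2 y t.
Proof.
  intros H1 H2 M. destruct (good_density_intg f2 H2) as [C2 I2].
  destruct (good_density_intg f1 H1) as [C1 _].
  assert (P := marg_pos _ _ _ _ _ M t). assert (O := overlap_intg _ _ _ _ _ M t s).
  assert (Pp := phi_pos _ _ _ _ _ M). assert (Pf := noise_pos _ _ _ _ _ M). simpl in Pp.
  assert (N : forall x, RInt_R (fun u => f2 (x - u)) = 1).
  { intros x. rewrite (RInt_R_reflect x f2). apply RInt_R_eq; auto. intros; now apply Rlt_le. }
  unfold gibbs_kernel, condX, condTheta_X.
  replace (fun u => f1 (y - u) * f2 (u - t) / cX f1 f2 y t *
                    (f2 (u - s) / RInt_R (fun t0 => f2 (u - t0))))
    with (fun u => / cX f1 f2 y t * (f1 (y - u) * f2 (u - t) * f2 (u - s))).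
  - unfold Rdiv. rewrite (Rmult_comm (overlap _ _ t s)).
    assert (C : cont (fun u => f1 (y - u) * f2 (u - t) * f2 (u - s))) by ctn.
    apply RInt_R_eq.
    + ctn.
    + intros u. apply Rmult_le_pos; [now apply Rlt_le, Rinv_0_lt_compat|].
      repeat apply Rmult_le_pos; now apply Rlt_le.
    + apply (intg_scal _ (fun u => f1 (y - u) * f2 (u - t) * f2 (u - s))); auto.
      now apply Rlt_le, Rinv_0_lt_compat.
  - apply functional_extensionality. intros u. rewrite N. field. lra.
Qed.

Lemma theta_dens_gibbs_density (f1 f2 : R -> R) (y B Z : R) :
  good_density f1 -> good_density f2 ->
  flat_model (fun x => f1 (y - x)) f2 (cX f1 f2 y) B Z ->
  forall n t0, theta_dens (gibbs_kernel (condX f1 f2 y) (condTheta_X f1 f2 y)) n t0 =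
               gibbs_density (fun x => f1 (y - x)) f2 (cX f1 f2 y) t0 n.
Proof.
  intros H1 H2 M n t0.
  assert (E : gibbs_kernel (condX f1 f2 y) (condTheta_X f1 f2 y) =
              fun t s => overlap (fun x => f1 (y - x)) f2 t s / cX f1 f2 y t).
  { apply functional_extensionality. intros t. apply functional_extensionality. intros s.
    exact (gibbs_kernel_overlap _ _ _ _ _ _ _ H1 H2 M). }
  rewrite E. induction n as [|n IH]; [reflexivity|]. simpl. now rewrite IH.
Qed.

Lemma RID_robust (f1 f2 : R -> R) (y B Z : R) :
  good_density f1 -> flat_model (fun x => f1 (y - x)) f2 (cX f1 f2 y) B Z ->
  RID f1 f2 y -> robust_in_data (fun x => f1 (y - x)) f2 (cX f1 f2 y).
Proof.
  intros H1 M HR h Ch h0 [H h1] j eps Hj He.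
  destruct (good_density_intg f1 H1) as [C1 _].
  assert (P := marg_pos _ _ _ _ _ M).
  assert (Pp := phi_pos _ _ _ _ _ M). assert (Cf := noise_cont _ _ _ _ _ M).
  assert (Pf := noise_pos _ _ _ _ _ M). assert (Hc := marg_intg _ _ _ _ _ M).
  simpl in Pp.
  destruct (HR h) with (eps := eps) as [T HT]; auto.
  { now apply continuity_cont. }
  { exists H. intros x. rewrite Rabs_right; auto. now apply Rle_ge. }
  exists (Rabs T). intros t Ht J HJ.
  assert (Pt := P t).
  assert (T1 := Rle_abs T). assert (T2 := Rle_abs t).
  specialize (HT t ltac:(lra)).
  assert (Ej : RInt_R (fun x => h x * f2 x) = j).
  { apply RInt_R_eq; auto; [ctn|]. intros x. apply Rmult_le_pos; auto. now apply Rlt_le. }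
  (* The two normalising constants agree by the translation x = u + t. *)
  assert (Ec : cXt f1 f2 y t = cX f1 f2 y t).
  { unfold cXt. apply RInt_R_eq.
    - ctn.
    - intros u. apply Rmult_le_pos; [|now apply Rlt_le].
      replace (y - t - u) with (y - (t + u)) by ring. now apply Rlt_le.
    - apply intg_ext with (fun u => f1 (y - (u + t)) * f2 (u + t - t)).
      + intros u. f_equal; f_equal; ring.
      + apply (intg_shift t (fun x => f1 (y - x) * f2 (x - t))); auto.
        * ctn.
        * intros u. apply Rmult_le_pos; now apply Rlt_le. }
  assert (EJ : RInt_R (fun x => h x * condXt f1 f2 y t x) = / cX f1 f2 y t * J).
  { assert (C : cont (fun u => h u * (f1 (y - (u + t)) * f2 u))) by ctn.
    replace (fun x => h x * condXt f1 f2 y t x)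
      with (fun u => / cX f1 f2 y t * (h u * (f1 (y - (u + t)) * f2 u))).
    - apply RInt_R_eq.
      + ctn.
      + intros u. apply Rmult_le_pos; [now apply Rlt_le, Rinv_0_lt_compat|].
        repeat apply Rmult_le_pos; auto; now apply Rlt_le.
      + apply (intg_scal _ (fun u => h u * (f1 (y - (u + t)) * f2 u))); auto.
        now apply Rlt_le, Rinv_0_lt_compat.
    - apply functional_extensionality. intros u. unfold condXt. rewrite Ec.
      replace (y - t - u) with (y - (u + t)) by ring. field. lra. }
  rewrite EJ, Ej in HT.
  replace (J - j * cX f1 f2 y t) with ((/ cX f1 f2 y t * J - j) * cX f1 f2 y t) by (field; lra).
  rewrite Rabs_mult, (Rabs_right (cX f1 f2 y t)) by lra.
  apply Rmult_le_compat_r; lra.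
Qed.

(** The definition of ergodicity allows r <= 0, whereas the energy argument needs a rate in (0, 1).
    For r < 0 the bounds at n = 0 and n = 1 have opposite signs, forcing M = 0; for r = 0 the bound
    is 0. *)
Lemma geometric_rate_normalise (a : nat -> R) (r M : R) :
  r < 1 -> (forall n, 0 <= a n) -> (forall n, a n <= M * r ^ S n) ->
  forall n, a n <= Rabs M * Rmax r (/ 2) ^ n.
Proof.
  intros Hr H0 H n.
  assert (X1 := Rmax_l r (/ 2)). assert (X2 := Rmax_r r (/ 2)).
  assert (X3 : Rmax r (/ 2) <= 1) by (apply Rmax_lub; lra).
  assert (Q : 0 <= Rmax r (/ 2) ^ n) by (apply pow_le; lra).
  assert (MP := Rabs_pos M). assert (ML := Rle_abs M).
  destruct (Rlt_le_dec 0 r) as [K|K].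
  - eapply Rle_trans; [apply H|].
    assert (R1 : r ^ S n <= Rmax r (/ 2) ^ n).
    { simpl. assert (r ^ n <= Rmax r (/ 2) ^ n) by (apply pow_incr; lra).
      assert (0 <= r ^ n) by (apply pow_le; lra). nra. }
    assert (R0 : 0 <= r ^ S n) by (apply pow_le; lra). nra.
  - assert (A : a n <= 0).
    { assert (A1 := H O). assert (A2 := H 1%nat). assert (A3 := H0 O). assert (A4 := H0 1%nat).
      specialize (H n). simpl in A1, A2.
      destruct (Req_dec r 0) as [->|N].
      - rewrite pow_i in H by lia. lra.
      - assert (M0 : M = 0); [|subst M; lra]. apply Rle_antisym.
        + apply Rnot_lt_le. intros L. nra.
        + apply Rnot_lt_le. intros L. assert (0 < r * r) by nra. nra. }
    assert (0 <= Rabs M * Rmax r (/ 2) ^ n) by (apply Rmult_le_pos; lra). lra.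
Qed.

Lemma RID_not_P0 (f1 f2 : R -> R) (y : R) :
  good_density f1 -> good_density f2 -> posterior_proper f1 f2 y ->
  RID f1 f2 y -> ~ P0_geom_ergodic f1 f2 y.
Proof.
  intros H1 H2 HZ HR (r & C & Hr & HT).
  destruct (flat_model_of_densities _ _ _ H1 H2 HZ) as (B & Z & M).
  assert (Cc := marg_cont _ _ _ _ _ M). assert (P := marg_pos _ _ _ _ _ M).
  assert (EZ : RInt_R (fun t => cX f1 f2 y t) = Z).
  { apply RInt_R_eq; [exact Cc|intros; now apply Rlt_le|exact (total_intg _ _ _ _ _ M)]. }
  apply (no_geometric_rate _ _ _ _ _ (Rmax r (/ 2)) (fun t => Rabs (C t)) M
           (RID_robust _ _ _ _ _ H1 M HR)).
  { assert (X := Rmax_r r (/ 2)). split; [lra|]. apply Rmax_lub_lt; lra. }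
  intros t0 j.
  assert (E : forall n, tv_dist (theta_dens (gibbs_kernel (condX f1 f2 y) (condTheta_X f1 f2 y)) n t0)
                          (post_theta f1 f2 y)
     = tv_dist (gibbs_density (fun x => f1 (y - x)) f2 (cX f1 f2 y) t0 n)
         (fun t => cX f1 f2 y t / Z)).
  { intros n. rewrite (theta_dens_gibbs_density _ _ _ _ _ H1 H2 M n t0). f_equal.
    apply functional_extensionality. intros t. unfold post_theta. now rewrite EZ. }
  apply (geometric_rate_normalise
    (fun n => tv_dist (gibbs_density (fun x => f1 (y - x)) f2 (cX f1 f2 y) t0 n)
                (fun t => cX f1 f2 y t / Z)) r (C t0) Hr).
  - intros n. apply (centred_square_le_tv _ _ _ _ _ _ _ M
      (gibbs_density_dominated _ _ _ _ _ t0 n M) (gibbs_density_mass _ _ _ _ _ t0 n M)).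
  - intros n. rewrite <- E. apply HT.
Qed.

(** * The reflection exchanging the two noises *)

Lemma cX_swap f1 f2 y th : cX f2 f1 y th = cX f1 f2 y th.
Proof.
  (* The substitution x -> y + th - x interchanges the arguments y - x and x - th. *)
  unfold cX. rewrite <- (RInt_R_reflect (y + th) (fun x => f1 (y - x) * f2 (x - th))).
  f_equal. apply functional_extensionality. intros x.
  rewrite Rmult_comm. f_equal; f_equal; ring.
Qed.

Lemma cXt_cX_swap f1 f2 y th : cXt f1 f2 y th = cX f2 f1 y th.
Proof.
  unfold cXt, cX. rewrite <- (RInt_R_reflect y (fun x => f2 (y - x) * f1 (x - th))).
  f_equal. apply functional_extensionality. intros u.
  rewrite Rmult_comm. f_equal; f_equal; ring.
Qed.

(** In the model with exchanged noises, y - X plays the role of the original X - Theta. *)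
Lemma condXt_condX_swap f1 f2 y th u : condXt f1 f2 y th u = condX f2 f1 y th (y - u).
Proof.
  unfold condXt, condX. rewrite cXt_cX_swap.
  replace (y - (y - u)) with u by ring. replace (y - u - th) with (y - th - u) by ring.
  now rewrite (Rmult_comm (f2 u)).
Qed.

Lemma P1_P0_swap f1 f2 y : P1_geom_ergodic f1 f2 y -> P0_geom_ergodic f2 f1 y.
Proof.
  unfold P1_geom_ergodic, P0_geom_ergodic, geom_ergodic.
  replace (gibbs_kernel (condX f2 f1 y) (condTheta_X f2 f1 y))
    with (gibbs_kernel (condXt f1 f2 y) (condTheta_Xt f1 f2 y)).
  - replace (post_theta f2 f1 y) with (post_theta f1 f2 y); [auto|].
    apply functional_extensionality. intros th. unfold post_theta. rewrite (cX_swap f1 f2).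
    do 2 f_equal. apply functional_extensionality. intros t. now rewrite cX_swap.
  - apply functional_extensionality. intros th. apply functional_extensionality. intros th'.
    unfold gibbs_kernel.
    rewrite <- (RInt_R_reflect y (fun x => condX f2 f1 y th x * condTheta_X f2 f1 y x th')).
    f_equal. apply functional_extensionality. intros u. now rewrite condXt_condX_swap.
Qed.

(** The test function is reflected to h(y - x). The limit density f1(x - y) becomes f1(-x), which
    symmetry identifies with f1(x). *)
Lemma RIP_RID_swap f1 f2 y : (forall x, f1 (- x) = f1 x) -> RIP f1 f2 y -> RID f2 f1 y.
Proof.
  intros Hs H h Ch [B HB] eps He.
  destruct (H (fun x => h (y - x))) with (eps := eps) as [T HT]; auto.
  - apply continuity_cont in Ch. apply continuity_cont. ctn.
  - exists B. auto.
  - exists T. intros th Hth. specialize (HT th Hth).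
    replace (RInt_R (fun x => h x * condXt f2 f1 y th x))
      with (RInt_R (fun x => h (y - x) * condX f1 f2 y th x)).
    + replace (RInt_R (fun x => h x * f1 x)) with (RInt_R (fun x => h (y - x) * f1 (x - y))); auto.
      rewrite <- (RInt_R_reflect y (fun x => h x * f1 x)). f_equal.
      apply functional_extensionality. intros x. rewrite <- (Hs (x - y)). do 2 f_equal. ring.
    + rewrite <- (RInt_R_reflect y (fun x => h x * condXt f2 f1 y th x)). f_equal.
      apply functional_extensionality. intros x. rewrite condXt_condX_swap. do 2 f_equal. ring.
Qed.

Lemma posterior_proper_swap f1 f2 y : posterior_proper f1 f2 y -> posterior_proper f2 f1 y.
Proof.
  intros (Z & Z0 & HZ). exists Z. split; auto.
  replace (fun th => cX f2 f1 y th) with (fun th => cX f1 f2 y th); auto.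
  apply functional_extensionality. intros t. now rewrite cX_swap.
Qed.

Theorem mainTheorem2 (f1 f2 : R -> R) (y : R)
  (hf1 : good_density f1) (hf2 : good_density f2)
  (hprop : posterior_proper f1 f2 y) :
  (RID f1 f2 y -> ~ P0_geom_ergodic f1 f2 y) /\
  (RIP f1 f2 y -> ~ P1_geom_ergodic f1 f2 y).
Proof.
  split; [exact (RID_not_P0 f1 f2 y hf1 hf2 hprop)|].
  intros HR HP. apply (RID_not_P0 f2 f1 y hf2 hf1).
  - now apply posterior_proper_swap.
  - apply RIP_RID_swap; auto. apply hf1.
  - now apply P1_P0_swap.
Qed.
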